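(* Let $\theta \in (0,1]$ and let $a=\{a_n\}_{n\ge 1}$ be a positive, non-increasing, summable sequence with $\sum_{n\ge 1} a_n = 1$. Suppose that $$2 < \inf_n \frac{s_n(a)}{s_{n+1}(a)} \leq \sup_n \frac{s_n(a)}{s_{n+1}(a)} < \infty .$$ Then for every $t \in \left[\overline{\dim}_\theta D_a,\ \overline{\dim}_\theta C_a\right]$ there exists a set $E=E(t,\theta)\in\mathcal{C}_a$ such that $\overline{\dim}_\theta E = t$. Likewise, for every $t \in \left[\underline{\dim}_\theta D_a,\ \underline{\dim}_\theta C_a\right]$ there exists a set $E'=E'(t,\theta)\in\mathcal{C}_a$ such that $\underline{\dim}_\theta E' = t$.
   Context: Intermediate dimensions. Write $|U|$ for the diameter of $U\subset\mathbb{R}$. For bounded $F\subseteq\mathbb{R}$ and $\theta\in(0,1]$, the lower $\theta$-intermediate dimension $\underline{\dim}_\theta F$ is the infimum of all $s\ge 0$ such that for every $\epsilon>0$ and every $\delta_0>0$ there exist $0<\delta\le\delta_0$ and a cover $\{U_i\}_{i\in I}$ of $F$ with $\delta^{1/\theta}\le |U_i|\le \delta$ for all $i$ and $\sum_{i}|U_i|^s\le\epsilon$. The upper $\theta$-intermediate dimension $\overline{\dim}_\theta F$ is the infimum of all $s\ge 0$ such that for every $\epsilon>0$ there exists $\delta_0>0$ such that for every $0<\delta\le\delta_0$ there is a cover $\{U_i\}_{i\in I}$ of $F$ with $\delta^{1/\theta}\le |U_i|\le \delta$ for all $i$ and $\sum_{i}|U_i|^s\le\epsilon$. Complementary sets.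 For a positive, non-increasing sequence $a=\{a_n\}_{n\ge1}$ with sum $1$, $\mathcal{C}_a$ is the family of all closed sets $E\subset[0,1]$ of the form $E=[0,1]\setminus\bigcup_{j\ge1}U_j$, where $\{U_j\}$ is a disjoint family of open intervals contained in $[0,1]$ with $|U_j|=a_j$ for all $j$. The countable set is $D_a=\{\sum_{i=k}^\infty a_i : k\in\mathbb{N}\}$. The Cantor set $C_a$ is constructed as follows. In the first step remove from $[0,1]$ an open interval of length $a_1$, leaving two closed intervals $I_{1,1}$ (left) and $I_{1,2}$ (right). After the $k$-th step there are $2^k$ closed intervals $I_{k,1},\dots,I_{k,2^k}$ (numbered from left to right); from each $I_{k,j}$ remove an open interval of length $a_{2^k+j-1}$ to obtain two closed intervals $I_{k+1,2j-1}$ and $I_{k+1,2j}$. The positions of the removed intervals are uniquely determined because the total removed length is $1$: the length of $I_{k,j}$ equals the sum of the lengths of all gaps subsequently removed from it, i.e. $|I_{k,j}|=\sum_{m\ge0}\sum_{i=0}^{2^m-1}a_{2^{k+m}+2^m(j-1)+i}$. Then $C_a=\bigcap_{k\ge1}\bigcup_{j=1}^{2^k}I_{k,j}$. Finally, $s_n(a)=2^{-n}\sum_{i=2^n}^\infty a_i$. *)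

(* Defs.v *)
From HB Require Import structures.
From mathcomp Require Import all_boot all_order all_algebra.
From mathcomp Require Import all_classical all_reals all_analysis.

Set Implicit Arguments.
Unset Strict Implicit.
Unset Printing Implicit Defensive.

Import Order.TTheory GRing.Theory Num.Theory.
Import numFieldNormedType.Exports.

Local Open Scope classical_set_scope.
Local Open Scope ring_scope.

(* The added 0 only matters for the empty set, whose diameter is 0 and not the
   supremum -oo of the empty set. *)
Definition diam (R : realType) (U : set R) : \bar R :=
  ereal_sup ([set (0 : R)%:E] `|` [set (`|x - y|)%:E | x in U & y in U]).

(* F has a cover {U_i} with delta^(1/theta) <= |U_i| <= delta for all i and
   \sum_i |U_i|^s <= eps. *)
Definition has_intermediate_cover (R : realType) (theta : R) (F : set R)
    (s eps delta : R) : Prop :=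
  exists (I : choiceType) (U : I -> set R),
    [/\ F `<=` \bigcup_(i in [set: I]) U i,
        forall i, ((delta `^ theta^-1)%:E <= diam (U i) <= delta%:E)%E
      & (\esum_(i in [set: I]) poweR (diam (U i)) s <= eps%:E)%E].

(* Both dimensions are meant for bounded F: the set of exponents s then contains
   every s > 1, so that its infimum in R is the genuine one. *)
Definition lower_intermediate_dim (R : realType) (theta : R) (F : set R) : R :=
  inf [set s : R | 0 <= s /\
    forall eps delta0 : R, 0 < eps -> 0 < delta0 ->
    exists delta : R, 0 < delta <= delta0 /\
      has_intermediate_cover theta F s eps delta].

Definition upper_intermediate_dim (R : realType) (theta : R) (F : set R) : R :=
  inf [set s : R | 0 <= s /\
    forall eps : R, 0 < eps ->
    exists delta0 : R, 0 < delta0 /\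
      forall delta : R, 0 < delta <= delta0 ->
        has_intermediate_cover theta F s eps delta].

(* Sequences a = {a_n}_{n >= 1} are functions on nat whose value at 0 is never
   used. *)

Definition complementary_set (R : realType) (a : nat -> R) (E : set R) : Prop :=
  closed E /\
  exists U : nat -> set R,
    [/\ trivIset [set j | (1 <= j)%N] U,
        forall j, (1 <= j)%N ->
          [/\ exists l r : R, U j = `]l, r[%classic, U j `<=` `[0, 1]%classic
            & diam (U j) = (a j)%:E]
      & E = `[0, 1]%classic `\` \bigcup_(j in [set j | (1 <= j)%N]) U j].

Definition tail_sum (R : realType) (a : nat -> R) (k : nat) : R :=
  limn (fun n => \sum_(k <= i < n) a i).

Definition countable_set (R : realType) (a : nat -> R) : set R :=
  [set tail_sum a k | k in [set k | (1 <= k)%N]].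

(* The Cantor set. At level k the 2 ^ k intervals are numbered from left to
   right by j = 0, ..., 2 ^ k - 1 (so j stands for the usual index j + 1), level
   0 being [0, 1] itself. Interval j of level k loses a gap of length
   a (2 ^ k + j) and splits into the intervals 2 * j and 2 * j + 1 of level
   k + 1. *)
Definition cantor_len (R : realType) (a : nat -> R) (k j : nat) : R :=
  limn (fun n => \sum_(0 <= m < n)
    \sum_(0 <= i < 2 ^ m) a (2 ^ (k + m) + 2 ^ m * j + i)%N).

Fixpoint cantor_left (R : realType) (a : nat -> R) (k j : nat) : R :=
  match k with
  | 0%N => 0
  | k'.+1 =>
      if odd j then
        cantor_left a k' j./2 + cantor_len a k'.+1 j.-1 + a (2 ^ k' + j./2)%N
      else cantor_left a k' j./2
  end.

Definition cantor_itv (R : realType) (a : nat -> R) (k j : nat) : set R :=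
  `[cantor_left a k j, cantor_left a k j + cantor_len a k j]%classic.

Definition cantor_set (R : realType) (a : nat -> R) : set R :=
  \bigcap_(k in [set k | (1 <= k)%N])
    \bigcup_(j in [set j | (j < 2 ^ k)%N]) cantor_itv a k j.

Definition dyadic_avg (R : realType) (a : nat -> R) (n : nat) : R :=
  2 ^- n * tail_sum a (2 ^ n)%N.

(* Main.v *)
Require Import Defs.
From HB Require Import structures.
From mathcomp Require Import all_boot all_order all_algebra.
From mathcomp Require Import all_classical all_reals all_analysis.
From mathcomp Require Import finmap lra ring zify.

(** Why the theorem holds.  For 0 <= lam <= 1 there is a set E_lam in C_a such
    that E_0 is D_a together with its limit point 0, E_1 contains C_a, and
    both intermediate dimensions are nondecreasing and 1-Lipschitz functions
    of lam.  The intermediate value theorem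
    ([lipschitz_intermediate_value]) then yields every t.

    Construction.  For lam > 0 put L(k) = floor (k / lam) and build the Cantor
    set whose 2^k gaps of level k are a (2^L(k) + j), j < 2^k: it is the
    Cantor set of the subsequence [thin a lam].  The remaining gaps of a are
    laid out in decreasing order to its right, as in D_a.  So lam is the rate
    at which the number of Cantor pieces grows against the number of gaps
    spent; lam = 1 spends all gaps on the Cantor part.

    Comparison of covers.  Since |U_i|^s >= delta^(s/theta), a cover of finite
    cost is finite and may be taken to consist of closed intervals with
    lengths in [lo, hi] = [delta^(1/theta), delta].
    - The countable part never costs more than twice any set of C_a.  If n
      intervals cover some set of C_a, a gap that is not covered has the left
      end of some interval in it or at its right end, so at most n gaps escape
      and the total length of the intervals is at least the tail sum
      a_(n+1) + a_(n+2) + ... ([tail_le_cover_length]).  The same n lengths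
      stacked end to end cover all but n points of the countable part, and a
      second copy of them covers these one by one
      ([gap_cover_shifted_tails]).
    - A Cantor set is covered most cheaply by one level.  Giving mass 2^-k to
      the intervals of level k, an interval shorter than the gaps of the levels
      before k has mass at most 2^-k; weighing the members of a cover by their
      masses shows that some length d of the cover satisfies 2^k d^s <= cost
      for its level k ([cantor_cover_level]).
    - Conversely the 2^k intervals of level k have length at most
      s_(L(k)-1)(a) ([thin_cantor_len_le]), while the hypothesis on
      inf s_n / s_(n+1) makes a_(2^n) at least s_(n+r) for a fixed r
      ([dyadic_gap_lower_bound]).  Thus the length d just found covers the
      Cantor part for lam' at a level about k lam' / lam.  As
      d <= 2^-L(k), the extra factor 2^(k (lam' - lam) / lam) is at most a
      constant times d^-(lam' - lam): raising the exponent by lam' - lam pays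
      for it ([cantor_cover_transfer]).  From lam = 0, where no Cantor part
      has to be compared, the cost is bounded directly
      ([thin_cantor_dominated]).

    These bounds hold for each delta separately, so they serve the upper and
    the lower dimension alike ([upper_dim_le], [lower_dim_le]). *)

Set Implicit Arguments.
Unset Strict Implicit.
Unset Printing Implicit Defensive.

Import Order.TTheory GRing.Theory Num.Theory.
Import numFieldNormedType.Exports.

Local Open Scope classical_set_scope.
Local Open Scope ring_scope.

(** * Covers by finitely many closed intervals *)

Lemma diam_itv (R : realType) (b1 b2 : bool) (x y : R) : x < y ->
  diam [set` Interval (BSide b1 x) (BSide b2 y)] = (y - x)%:E.
Proof.
move=> xy; apply/eqP; rewrite eq_le; apply/andP; split.
  apply: ge_ereal_sup => w [->|]; first by rewrite lee_fin subr_ge0 ltW.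
  move=> [u uI] [v vI] {w}<-; move: uI vI.
  rewrite /= !in_itv /= => /andP[xu uy] /andP[xv vy].
  rewrite lee_fin ler_norml.
  have := lteifW xu; have := lteifW uy; have := lteifW xv; have := lteifW vy.
  by move=> *; apply/andP; split; lra.
apply/lee_addgt0Pr => e e0.
pose h := Num.min (e / 2) ((y - x) / 2).
have h0 : 0 < h by rewrite lt_min; apply/andP; split; lra.
have he : h <= e / 2 by rewrite ge_min lexx.
have hxy : h <= (y - x) / 2 by rewrite ge_min lexx orbT.
apply: (@le_trans _ _ (`|(y - h / 2) - (x + h / 2)|%:E + e%:E)%E); last first.
  rewrite leeD2r //; apply: ereal_sup_ubound; right.
  have inI u : x < u -> u < y ->
      [set` Interval (BSide b1 x) (BSide b2 y)] u.
    by move=> xu uy; rewrite /= in_itv /= !lteifS.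
  exists (y - h / 2); first by apply: inI; lra.
  by exists (x + h / 2) => //; apply: inI; lra.
rewrite -EFinD lee_fin ger0_norm; lra.
Qed.

Lemma diam_bounding_itv (R : realType) (U : set R) (d : R) :
  diam U = d%:E -> exists x, forall y, U y -> x <= y <= x + d.
Proof.
move=> dU.
have dist x y : U x -> U y -> `|x - y| <= d.
  move=> Ux Uy; rewrite -lee_fin -dU; apply: ereal_sup_ubound; right.
  by exists x => //; exists y.
have [->|/set0P[u Uu]] := eqVneq U set0; first by exists 0.
have lbU z : U z -> lbound U (z - d).
  by move=> Uz y Uy; have := dist _ _ Uz Uy; rewrite ler_norml; lra.
exists (inf U) => y Uy; apply/andP; split.
  by apply: ge_inf => //; exists (u - d); exact: lbU.
by rewrite -lerBlDr; apply: lb_le_inf; [exists u|exact: lbU].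
Qed.

(** A pair (x, d) stands for the closed interval [x, x + d], whose length d is
    what is bounded by [lo] and [hi] and what enters the cost. *)
Definition finite_cover (R : realType) (lo hi : R) (F : set R) (s eps : R) :=
  exists l : seq (R * R),
    [/\ forall p, p \in l -> lo <= p.2 <= hi,
        forall y, F y -> exists2 p, p \in l & p.1 <= y <= p.1 + p.2
      & \sum_(p <- l) p.2 `^ s <= eps].

(** Every term of the cost is at least [lo `^ s > 0], so a finite cost leaves
    only finitely many indices. *)
Lemma intermediate_cover_finite (R : realType) (theta : R) (F : set R)
    (s eps delta : R) : 0 <= s -> 0 < delta ->
  has_intermediate_cover theta F s eps delta ->
  finite_cover (delta `^ theta^-1) delta F s eps.
Proof.
move=> s0 delta0 [I [U [FU dU sumU]]].
set lo := delta `^ theta^-1 in dU *.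
have lo0 : 0 < lo by exact: powR_gt0.
have dE i : diam (U i) = (fine (diam (U i)))%:E.
  rewrite fineK // fin_numE; apply/andP; split; apply/eqP => dUi;
    by have := dU i; rewrite dUi ?leeNy_eq ?leye_eq ?andbF.
pose d i := fine (diam (U i)).
have dI i : lo <= d i <= delta by have := dU i; rewrite dE !lee_fin.
have ds i : poweR (diam (U i)) s = (d i `^ s)%:E by rewrite dE poweR_EFin.
have finI : finite_set [set: I].
  apply: contrapT => infI.
  have los0 : 0 < lo `^ s by exact: powR_gt0.
  pose N := (Num.truncn (eps / lo `^ s)).+1.
  have [B _ NB] := infinite_set_fset N infI.
  suff : (eps%:E < \esum_(i in [set: I]) poweR (diam (U i)) s)%E.
    by rewrite ltNge sumU.
  apply: (@lt_le_trans _ _ (N%:R * lo `^ s)%:E).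
    by rewrite lte_fin -ltr_pdivrMr // truncnS_gt.
  apply: esum_ge; exists [set` B]; first by split=> //; exact: finite_fset.
  rewrite fsbig_finite //= set_fsetK.
  rewrite (eq_bigr (fun i => (d i `^ s)%:E)) => [|i _]; last exact: ds.
  rewrite sumEFin lee_fin.
  apply: (@le_trans _ _ (\sum_(i <- B) lo `^ s)).
    by rewrite big_const_seq count_predT iter_addr_0 -[leRHS]mulr_natl
       ler_wpM2r ?ler_nat // powR_ge0.
  apply: ler_sum => i _; apply: ge0_ler_powR => //; rewrite ?nnegrE //.
  - exact: ltW.
  - by have /andP[/(lt_le_trans lo0)/ltW] := dI i.
  - by have /andP[] := dI i.
have /choice[x xU] : forall i, exists x, forall y, U i y -> x <= y <= x + d i.
  by move=> i; apply: diam_bounding_itv; rewrite dE.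
exists [seq (x i, d i) | i <- fset_set [set: I]]; split.
- by move=> p /mapP[i _ ->]; exact: dI.
- move=> y /FU[i _ Uiy]; exists (x i, d i); last exact: xU.
  by apply: (map_f (fun i => (x i, d i))); rewrite in_fset_set // in_setT.
- rewrite big_map -lee_fin; apply: le_trans sumU.
  rewrite esum_fset //; last by move=> i _; rewrite ds lee_fin powR_ge0.
  rewrite fsbig_finite //= -sumEFin le_eqVlt; apply/predU1l.
  by apply: eq_bigr => i _; rewrite ds.
Qed.

Lemma finite_cover_intermediate (R : realType) (theta : R) (F : set R)
    (s eps delta : R) : 0 < delta ->
  finite_cover (delta `^ theta^-1) delta F s eps ->
  has_intermediate_cover theta F s eps delta.
Proof.
move=> delta0 [l [dl Fl suml]].
have lo0 : 0 < delta `^ theta^-1 by exact: powR_gt0.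
pose p i := nth (0, 0) l i.
have pl (i : 'I_(size l)) : p i \in l by exact: mem_nth.
have dU (i : 'I_(size l)) :
    diam (`[(p i).1, (p i).1 + (p i).2]%classic) = (p i).2%:E.
  have /dl/andP[+ _] := pl i => /(lt_le_trans lo0) d0.
  by rewrite diam_itv ?ltrDl // addrAC subrr add0r.
have finI : finite_set [set: 'I_(size l)] by exact: finite_finset.
exists 'I_(size l), (fun i : 'I_(size l) =>
  `[(p i).1, (p i).1 + (p i).2]%classic); split.
- move=> y /Fl[q ql qy].
  have iq : (index q l < size l)%N by rewrite index_mem.
  by exists (Ordinal iq) => //=; rewrite in_itv /= /p nth_index.
- by move=> i; rewrite dU !lee_fin; exact/dl/pl.
- rewrite esum_fset //; last by move=> i _; exact: poweR_ge0.
  rewrite fsbig_finite //=.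
  rewrite (eq_bigr (fun i : 'I_(size l) => ((p i).2 `^ s)%:E)); last first.
    by move=> i _; rewrite dU poweR_EFin.
  rewrite sumEFin lee_fin; apply: le_trans suml.
  rewrite (big_nth (0, 0)) big_mkord le_eqVlt; apply/predU1l.
  rewrite -big_enum /=; apply: perm_big.
  apply: uniq_perm; rewrite ?fset_uniq ?enum_uniq // => i.
  by rewrite in_fset_set // mem_enum in_setT.
Qed.

(** * Comparing dimensions by comparing covers *)

Lemma inf_exponents_le (R : realType) (A B : set R) (eta : R) :
  A !=set0 -> (forall s, B s -> 0 <= s) ->
  (forall s e, A s -> 0 < e -> B (s + eta + e)) -> inf B <= inf A + eta.
Proof.
move=> A0 B_ge0 AB; have [lbA|nlbA] := pselect (has_lbound A); last first.
  have [u Au] := A0; exfalso; apply: nlbA; exists (- eta - 1) => s As.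
  by have := B_ge0 _ (AB s 1 As ltr01); lra.
apply/ler_addgt0Pr => e e0.
have e20 : 0 < e / 2 by lra.
have [s As sA] := inf_adherent e20 (conj A0 lbA).
have : inf B <= s + eta + e / 2.
  by apply: ge_inf; [exists 0 => ? /B_ge0|exact: AB].
by lra.
Qed.

(** Cheap covers of F give cheap covers of G at the same scale and at an
    exponent larger by [eta].  The slack [e] absorbs constants and powers of
    delta, and [eps'] and [delta1] may depend on everything but delta. *)
Definition cover_dominated (R : realType) (theta eta : R) (F G : set R) :=
  forall s e eps : R, 0 <= s -> 0 < e -> 0 < eps ->
  exists2 eps', 0 < eps' & exists2 delta1, 0 < delta1 &
    forall delta, 0 < delta <= delta1 ->
      finite_cover (delta `^ theta^-1) delta F s eps' ->
      finite_cover (delta `^ theta^-1) delta G (s + eta + e) eps.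

Lemma powR_inv_le (R : realType) (theta delta : R) :
  0 < theta <= 1 -> 0 < delta <= 1 -> delta `^ theta^-1 <= delta.
Proof.
move=> /andP[theta0 theta1] delta01; have /andP[delta0 _] := delta01.
rewrite -[leRHS]powRr1; last exact: ltW.
apply: (ger_powR delta01).
by rewrite -[leLHS]invr1 lef_pV2 // posrE.
Qed.

(** At exponent 2 a bounded set is covered at vanishing cost, so the sets of
    exponents whose infima are the dimensions are not empty. *)
Lemma unit_itv_cover (R : realType) (theta : R) (F : set R) (delta : R) :
  0 < theta <= 1 -> F `<=` `[0, 1]%classic -> 0 < delta <= 1 ->
  finite_cover (delta `^ theta^-1) delta F 2 (2 * delta).
Proof.
move=> theta01 F01 delta01; have /andP[delta0 delta1] := delta01.
pose N := (Num.truncn delta^-1).+1.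
exists [seq (i%:R * delta, delta) | i <- iota 0 N]; split.
- by move=> p /mapP[i _ ->] /=; rewrite lexx andbT; exact: powR_inv_le.
- move=> y Fy; have /andP[y0 y1] : 0 <= y <= 1.
    by have := F01 _ Fy; rewrite /= in_itv.
  have yd0 : 0 <= y / delta by rewrite divr_ge0 // ltW.
  have /andP[iy yi] := truncn_itv yd0.
  exists ((Num.truncn (y / delta))%:R * delta, delta).
    apply/mapP; exists (Num.truncn (y / delta)) => //.
    rewrite mem_iota add0n /= /N ltnS; apply: le_truncn.
    by rewrite ler_pdivrMr // mulVf ?gt_eqF.
  rewrite /= -ler_pdivlMr // iy /=.
  by move: yi; rewrite ltr_pdivrMr // -natr1 mulrDl mul1r => /ltW.
- rewrite big_map (eq_bigr (fun=> delta `^ 2)) //.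
  rewrite big_const_seq count_predT size_iota iter_addr_0.
  have delta_ge0 := ltW delta0.
  rewrite powR_mulrn // -[leLHS]mulr_natl expr2 mulrA ler_wpM2r //.
  rewrite -ler_pdivlMr //.
  have : N%:R = (Num.truncn delta^-1)%:R + 1 :> R by rewrite natr1.
  have : (Num.truncn delta^-1)%:R <= delta^-1.
    by rewrite truncn_le // invr_ge0 ltW.
  have : 1 <= delta^-1 by rewrite invf_ge1.
  by lra.
Qed.

Lemma unit_upper_exponent (R : realType) (theta : R) (F : set R) :
  0 < theta <= 1 -> F `<=` `[0, 1]%classic ->
  forall eps : R, 0 < eps -> exists delta0 : R, 0 < delta0 /\
      forall delta : R, 0 < delta <= delta0 ->
        has_intermediate_cover theta F 2 eps delta.
Proof.
move=> theta01 F01 eps eps0; exists (Num.min 1 (eps / 2)); split.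
  by rewrite lt_min ltr01 divr_gt0.
move=> delta /andP[delta0]; rewrite le_min => /andP[delta1 deltae].
apply: finite_cover_intermediate => //.
have [|l [dl Fl suml]] := unit_itv_cover theta01 F01 (delta := delta).
  by rewrite delta0.
by exists l; split=> //; apply: le_trans suml _; lra.
Qed.

Lemma upper_dim_le (R : realType) (theta eta : R) (F G : set R) :
  0 < theta <= 1 -> 0 <= eta -> F `<=` `[0, 1]%classic ->
  cover_dominated theta eta F G ->
  upper_intermediate_dim theta G <= upper_intermediate_dim theta F + eta.
Proof.
move=> theta01 eta0 F01 FG; apply: inf_exponents_le.
- by exists 2; split=> //; exact: unit_upper_exponent.
- by move=> s [].
- move=> s e [s0 Fs] e0; split; first by lra.
  move=> eps eps0; have [eps' eps'0 [d1 d10 FGs]] := FG s e eps s0 e0 eps0.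
  have [d0 [d00 Fd]] := Fs _ eps'0.
  exists (Num.min d0 d1); split; first by rewrite lt_min d00.
  move=> delta /andP[delta0]; rewrite le_min => /andP[dd0 dd1].
  apply: finite_cover_intermediate => //; apply: FGs; first by rewrite delta0.
  by apply: intermediate_cover_finite => //; apply: Fd; rewrite delta0.
Qed.

Lemma lower_dim_le (R : realType) (theta eta : R) (F G : set R) :
  0 < theta <= 1 -> 0 <= eta -> F `<=` `[0, 1]%classic ->
  cover_dominated theta eta F G ->
  lower_intermediate_dim theta G <= lower_intermediate_dim theta F + eta.
Proof.
move=> theta01 eta0 F01 FG; apply: inf_exponents_le.
- exists 2; split=> // eps delta0 eps0 delta00.
  have [d0 [d00 Fd]] := unit_upper_exponent theta01 F01 eps0.
  have m0 : 0 < Num.min d0 delta0 by rewrite lt_min d00.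
  exists (Num.min d0 delta0); split; first by rewrite m0 ge_min lexx orbT.
  by apply: Fd; rewrite m0 ge_min lexx.
- by move=> s [].
- move=> s e [s0 Fs] e0; split; first by lra.
  move=> eps delta0 eps0 delta00.
  have [eps' eps'0 [d1 d10 FGs]] := FG s e eps s0 e0 eps0.
  have m0 : 0 < Num.min d1 delta0 by rewrite lt_min d10.
  have [delta [/andP[d_gt0 +] Fd]] := Fs _ _ eps'0 m0.
  rewrite le_min => /andP[dd1 dd0].
  exists delta; split; first by rewrite d_gt0.
  apply: finite_cover_intermediate => //; apply: FGs; first by rewrite d_gt0.
  exact: intermediate_cover_finite.
Qed.

(** Precomposing with the projection of the line onto [0, 1] turns the one-sided
    bounds into a Lipschitz, hence continuous, function on the whole line. *)
Lemma lipschitz_intermediate_value (R : realType) (f : R -> R) (t : R) :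
  (forall x y, 0 <= x -> x <= y -> y <= 1 -> f x <= f y <= f x + (y - x)) ->
  f 0 <= t <= f 1 -> exists2 x, 0 <= x <= 1 & f x = t.
Proof.
move=> f_lip f01.
pose clamp x : R := Num.max 0 (Num.min 1 x).
have clampP x : [\/ x <= 0 /\ clamp x = 0, 0 <= x <= 1 /\ clamp x = x
    | 1 <= x /\ clamp x = 1].
  rewrite /clamp; case: (leP 1 x) => x1.
    by apply: Or33; split=> //; rewrite max_r // ler01.
  case: (leP 0 x) => x0; first by apply: Or32; split=> //; exact: ltW.
  by apply: Or31; split=> //; exact: ltW.
have clamp01 x : 0 <= clamp x <= 1.
  by case: (clampP x) => -[? ->]; lra.
have clampE x : 0 <= x <= 1 -> clamp x = x.
  by move=> /andP[? ?]; case: (clampP x) => -[? ->]; lra.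
have clamp_lip x y : x <= y -> clamp x <= clamp y <= clamp x + (y - x).
  by case: (clampP x) => -[? ->]; case: (clampP y) => -[? ->]; lra.
pose g := f \o clamp.
have g_lip x y : `|g x - g y| <= `|x - y|.
  wlog xy : x y / x <= y.
    by move=> H; case: (leP x y) => [/H//|/ltW/H]; rewrite distrC (distrC y).
  have /andP[cx cy] := clamp_lip x y xy.
  have /andP[? ?] := clamp01 x; have /andP[? ?] := clamp01 y.
  have /andP[? ?] : f (clamp x) <= f (clamp y)
      <= f (clamp x) + (clamp y - clamp x) by exact: f_lip.
  rewrite (distrC x) (ger0_norm (x := y - x)) ?subr_ge0 // distrC.
  by rewrite /g /= ger0_norm ?subr_ge0 //; lra.
have g_cont : continuous g.
  move=> x; apply/cvgrPdist_le => e e0; near=> y.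
  apply: le_trans (g_lip _ _) _.
  by near: y; apply: (@cvgr_dist_le _ _ _ _ _ id x _ e e0); exact: cvg_id.
have [||c] := @IVT R g 0 1 t ler01.
- exact: continuous_subspaceT.
- rewrite /g /= !clampE ?lexx ?ler01 //; have /andP[? ?] := f01.
  by rewrite ge_min le_max; apply/andP; split; apply/orP; [left|right].
by rewrite in_itv /= => c01 gc; exists c => //; rewrite -gc /g /= clampE.
Unshelve. all: by end_near.
Qed.

(** * Tail sums *)

Lemma nondecreasing_lim (R : realType) (u : nat -> R) (M : R) :
  {homo u : m n / (m <= n)%N >-> m <= n} -> (forall n, u n <= M) ->
  (forall n, u n <= limn u) /\
  (forall M', (forall n, u n <= M') -> limn u <= M').
Proof.
move=> u_nd uM.
have u_cvg : cvgn u.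
  by apply: nondecreasing_is_cvgn => //; exists M => _ [n _ <-].
split; first exact: nondecreasing_cvgn_le.
by move=> M' uM'; apply: limr_le => //; exact: nearW.
Qed.

Definition subunit_seq (R : realType) (c : nat -> R) :=
  (forall n, (1 <= n)%N -> 0 <= c n) /\
  (forall n, \sum_(1 <= i < n) c i <= 1).

Lemma sum_nat_nondecreasing (R : realType) (c : nat -> R) (k : nat) :
  (forall n, (k <= n)%N -> 0 <= c n) ->
  {homo (fun n => \sum_(k <= i < n) c i) : m n / (m <= n)%N >-> m <= n}.
Proof.
move=> c0 m n mn; case: (leqP k m) => [km|mk]; last first.
  rewrite big_geq; last exact: ltnW.
  by rewrite big_nat_cond; apply: sumr_ge0 => i /andP[/andP[/c0]].
rewrite (big_cat_nat km mn) /= lerDl big_nat_cond; apply: sumr_ge0.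
by move=> i /andP[/andP[mi _] _]; apply: c0; exact: leq_trans mi.
Qed.

Section Tails.
Context {R : realType}.
Implicit Types (c a : nat -> R) (k n : nat).

Lemma sum_nat_subunit c k n : subunit_seq c -> (1 <= k)%N ->
  \sum_(k <= i < n) c i <= 1.
Proof.
move=> [c0 c1] k0; apply: le_trans (c1 n).
case: (leqP k n) => [kn|nk]; last first.
  rewrite big_geq; last exact: ltnW.
  by rewrite big_nat_cond; apply: sumr_ge0 => i /andP[/andP[/c0]].
rewrite [leRHS](big_cat_nat k0 kn) /= lerDr big_nat_cond; apply: sumr_ge0.
by move=> i /andP[/andP[/c0]].
Qed.

Lemma tail_sum_lim c k : subunit_seq c -> (1 <= k)%N ->
  (forall n, \sum_(k <= i < n) c i <= tail_sum c k) /\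
  (forall M, (forall n, \sum_(k <= i < n) c i <= M) -> tail_sum c k <= M).
Proof.
move=> cu k0; apply: (@nondecreasing_lim _ _ 1).
  by apply: sum_nat_nondecreasing => n kn; apply: cu.1; exact: leq_trans kn.
by move=> n; exact: sum_nat_subunit.
Qed.

Lemma tail_sum_ge0 c k : subunit_seq c -> (1 <= k)%N -> 0 <= tail_sum c k.
Proof.
by move=> cu k0; have := (tail_sum_lim cu k0).1 0%N; rewrite big_geq.
Qed.

Lemma tail_sum_recl c k : subunit_seq c -> (1 <= k)%N ->
  tail_sum c k = c k + tail_sum c k.+1.
Proof.
move=> cu k0; apply/eqP; rewrite eq_le; apply/andP; split.
  apply: (tail_sum_lim cu k0).2 => n; case: (ltnP k n) => [kn|nk].
    by rewrite big_ltn // lerD2l; exact: (tail_sum_lim cu _).1.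
  by rewrite big_geq // addr_ge0 ?tail_sum_ge0 //; exact: cu.1.
rewrite -lerBrDl; apply: (tail_sum_lim cu _).2 => // n.
rewrite lerBrDl; case: (ltnP k n) => [kn|nk].
  by rewrite -big_ltn //; exact: (tail_sum_lim cu _).1.
rewrite [X in _ + X]big_geq ?addr0; last exact: leq_trans nk _.
by have := (tail_sum_lim cu k0).1 k.+1; rewrite big_nat1.
Qed.

Lemma tail_sum_split c k n : subunit_seq c -> (1 <= k)%N -> (k <= n)%N ->
  tail_sum c k = \sum_(k <= i < n) c i + tail_sum c n.
Proof.
move=> cu k0; elim: n => [|n IHn]; first by move=> /(leq_trans k0).
rewrite leq_eqVlt => /predU1P[->|kn]; first by rewrite big_geq // add0r.
rewrite big_nat_recr //= -addrA -tail_sum_recl //; first exact: IHn.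
by apply: leq_trans k0 _; rewrite -ltnS.
Qed.

Lemma tail_sum_anti c k n : subunit_seq c -> (1 <= k)%N -> (k <= n)%N ->
  tail_sum c n <= tail_sum c k.
Proof.
move=> cu k0 kn; rewrite (tail_sum_split cu k0 kn) lerDr big_nat_cond.
by apply: sumr_ge0 => i /andP[/andP[ki _] _]; apply: cu.1; exact: leq_trans ki.
Qed.

Lemma tail_sum_small c (e : R) : subunit_seq c -> 0 < e ->
  exists2 n, (1 <= n)%N & tail_sum c n < e.
Proof.
move=> cu e0; apply: contrapT => nex.
have big n : (1 <= n)%N -> e <= tail_sum c n.
  by move=> n0; rewrite leNgt; apply/negP => ?; apply: nex; exists n.
have : tail_sum c 1 <= tail_sum c 1 - e.
  apply: (tail_sum_lim cu _).2 => // n; case: (leqP 1 n) => n0.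
    by rewrite (@tail_sum_split _ 1 n) //; have := big n n0; lra.
  by rewrite big_geq ?(ltnW n0) //; have := big 1%N isT; lra.
by lra.
Qed.

Lemma subunit_seq_le c a : (forall n, (1 <= n)%N -> 0 <= c n <= a n) ->
  subunit_seq a -> subunit_seq c.
Proof.
move=> ca au; split; first by move=> n /ca/andP[].
move=> n; apply: le_trans (au.2 n).
by apply: ler_sum_nat => i /andP[/ca/andP[]].
Qed.

Lemma le_tail_sum c a k : (forall n, (1 <= n)%N -> 0 <= c n <= a n) ->
  subunit_seq a -> (1 <= k)%N -> tail_sum c k <= tail_sum a k.
Proof.
move=> ca au k0; have cu := subunit_seq_le ca au.
apply: (tail_sum_lim cu k0).2 => n.
apply: le_trans ((tail_sum_lim au k0).1 n).
apply: ler_sum_nat => i /andP[ki _].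
by have /andP[] := ca i (leq_trans k0 ki).
Qed.

Lemma cvg_sum1_subunit a : (forall n, (1 <= n)%N -> 0 <= a n) ->
  \sum_(1 <= i < n) a i @[n --> \oo] --> (1 : R) ->
  subunit_seq a /\ tail_sum a 1 = 1.
Proof.
move=> a0 a1; have lim1 : tail_sum a 1 = 1 by exact: cvg_lim.
split=> //; split=> // n; rewrite -lim1.
apply: (nondecreasing_cvgn_le (u_ := fun n => \sum_(1 <= i < n) a i)).
  exact: sum_nat_nondecreasing.
by apply/cvg_ex; exists 1.
Qed.

Lemma noninc_from1 a : (forall n, (1 <= n)%N -> a n.+1 <= a n) ->
  forall m n, (1 <= m)%N -> (m <= n)%N -> a n <= a m.
Proof.
move=> a_noninc m n m0 /subnK <-; elim: (n - m)%N => [|d IHd].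
  by rewrite add0n.
by apply: le_trans IHd; apply: a_noninc; rewrite addn_gt0 m0 orbT.
Qed.

Lemma subunit_sum_uniq a (s : seq nat) : subunit_seq a -> uniq s ->
  (forall j, j \in s -> (1 <= j)%N) -> \sum_(j <- s) a j <= 1.
Proof.
move=> au us s1.
pose N := (\max_(j <- s) j).+1.
have sN j : j \in s -> (j < N)%N.
  by move=> js; rewrite ltnS; exact: (@leq_bigmax_seq _ s xpredT id).
apply: le_trans (au.2 N).
rewrite [leRHS](bigID (mem s)) /= -[leLHS]addr0; apply: lerD; last first.
  by rewrite big_nat_cond; apply: sumr_ge0 => i /andP[/andP[/(au.1)]].
rewrite -[leRHS]big_filter le_eqVlt; apply/predU1l; apply: perm_big.
apply: uniq_perm => // [|j]; first by rewrite filter_uniq // iota_uniq.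
rewrite mem_filter mem_index_iota; apply/idP/idP => [js|/andP[]//].
by rewrite js s1 // sN.
Qed.

(** Among the sets of n indices the first n have the largest sum; by induction,
    removing an element that is at least n, which must exist. *)
Lemma sum_uniq_le_head a (s : seq nat) :
  (forall n, (1 <= n)%N -> a n.+1 <= a n) -> uniq s ->
  (forall j, j \in s -> (1 <= j)%N) ->
  \sum_(j <- s) a j <= \sum_(1 <= j < (size s).+1) a j.
Proof.
move=> /noninc_from1 a_mono.
move: {2}(size s) (erefl (size s)) => n; elim: n s => [|n IHn] s sn us s1.
  by rewrite (size0nil sn) big_nil.
have [x xs nx] : exists2 x, x \in s & (n < x)%N.
  apply: contrapT => nex; suff : (size s <= n)%N by rewrite sn ltnn.
  rewrite -[n](size_iota 1); apply: uniq_leq_size => // x xs.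
  rewrite mem_iota add1n ltnS s1 //= leqNgt; apply/negP => nx.
  by apply: nex; exists x.
rewrite (perm_big _ (perm_to_rem xs)) big_cons sn big_nat_recr //= addrC.
apply: lerD; last exact: a_mono.
have srem : size (rem x s) = n by rewrite size_rem // sn.
rewrite -srem; apply: IHn; rewrite ?rem_uniq // ?srem //.
by move=> j /mem_rem; exact: s1.
Qed.

End Tails.

(** * Families of gaps, and the length of a cover of their complement *)

(** Disjointness of open intervals in the order form used by the estimates. *)
Definition gap_family (R : realType) (a l r : nat -> R) :=
  [/\ forall j, (1 <= j)%N -> r j = l j + a j,
      forall j, (1 <= j)%N -> 0 <= l j /\ r j <= 1
    & forall i j, (1 <= i)%N -> (1 <= j)%N -> i <> j ->
        r i <= l j \/ r j <= l i].

Definition gap_complement (R : realType) (l r : nat -> R) : set R :=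
  `[0, 1]%classic `\` \bigcup_(j in [set j | (1 <= j)%N]) `]l j, r j[%classic.

Lemma gap_family_trivIset (R : realType) (a l r : nat -> R) (D : set nat) :
  gap_family a l r -> D `<=` [set j | (1 <= j)%N] ->
  trivIset D (fun j => `]l j, r j[%classic).
Proof.
move=> [_ _ lr_sep] D1 i j /D1/= i0 /D1/= j0 [x [/=]]; rewrite !in_itv /=.
move=> /andP[lix xri] /andP[ljx xrj].
apply: contrapT => ij; have [|] := lr_sep i j i0 j0 ij => rl.
  by have := lt_trans (lt_le_trans xri rl) ljx; rewrite ltxx.
by have := lt_trans (lt_le_trans xrj rl) lix; rewrite ltxx.
Qed.

Lemma gap_complement_complementary (R : realType) (a l r : nat -> R) :
  (forall j, (1 <= j)%N -> 0 < a j) -> gap_family a l r ->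
  complementary_set a (gap_complement l r).
Proof.
move=> a0 lr; have [ra lr01 _] := lr; split.
  apply: closedI; first exact: itv_closed.
  by apply: open_closedC; apply: bigcup_open => j _; exact: itv_open.
exists (fun j => `]l j, r j[%classic); split=> //.
- by apply: (gap_family_trivIset lr) => j.
- move=> j j0; have [l0 r1] := lr01 j j0; split.
  + by exists (l j), (r j).
  + move=> x /=; rewrite !in_itv /= => /andP[lx xr].
    by rewrite (le_trans l0 (ltW lx)) (le_trans (ltW xr) r1).
  + by rewrite diam_itv ra ?ltrDl ?a0 // addrAC subrr add0r.
Qed.

(** Additivity of Lebesgue measure on the disjoint gaps and subadditivity on the
    covering intervals. *)
Lemma sum_covered_gaps_le (R : realType) (a l r : nat -> R) (s : seq nat)
    (L : seq (R * R)) :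
  (forall j, (1 <= j)%N -> 0 <= a j) -> gap_family a l r -> uniq s ->
  (forall j, j \in s -> (1 <= j)%N) -> (forall p, p \in L -> 0 <= p.2) ->
  (forall j y, j \in s -> l j < y < r j ->
     exists2 p, p \in L & p.1 <= y <= p.1 + p.2) ->
  \sum_(j <- s) a j <= \sum_(p <- L) p.2.
Proof.
move=> a0 lr us s1 L0 sL; have [ra _ _] := lr.
pose mu := @lebesgue_measure R.
have gap_mu j : (1 <= j)%N -> mu `]l j, r j[%classic = (a j)%:E.
  move=> j0; rewrite /mu lebesgue_measure_itv /= lte_fin ra // ltrDl.
  have := a0 j j0; rewrite le_eqVlt => /predU1P[<-|aj0]; first by rewrite ltxx.
  by rewrite aj0 -EFinD addrAC subrr add0r.
have tr : trivIset [set` s] (fun j => `]l j, r j[%classic).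
  by apply: (gap_family_trivIset lr) => j /s1.
have musum : mu (\bigcup_(j in [set` s]) `]l j, r j[%classic)
    = (\sum_(j <- s) a j)%:E.
  have -> : mu (\bigcup_(j in [set` s]) `]l j, r j[%classic)
      = (\sum_(j \in [set` s]) mu `]l j, r j[%classic)%E.
    by apply: measure_fin_bigcup => //; exact: finite_seq.
  rewrite -sumEFin -fsbig_seq //= big_seq [RHS]big_seq.
  by apply: eq_bigr => j /s1; exact: gap_mu.
pose F i : set R :=
  `[(nth (0, 0) L i).1, (nth (0, 0) L i).1 + (nth (0, 0) L i).2]%classic.
have FL : (\sum_(i < size L) mu (F i) = (\sum_(p <- L) p.2)%:E)%E.
  rewrite (big_nth (0, 0)) big_mkord -sumEFin; apply: eq_bigr => i _.
  rewrite /mu lebesgue_measure_itv /= lte_fin ltrDl.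
  have := L0 _ (mem_nth (0, 0) (ltn_ord i)).
  rewrite le_eqVlt => /predU1P[<-|d0]; first by rewrite ltxx.
  by rewrite d0 -EFinD addrAC subrr add0r.
rewrite -lee_fin -musum -FL; apply: content_subadditive.
- by move=> k _; exact: measurable_itv.
- apply: fin_bigcup_measurable; first exact: finite_seq.
  by move=> j _; exact: measurable_itv.
- move=> y [j js]; rewrite /= in_itv /= => /(sL _ _ js)[p pL py].
  rewrite -bigcup_mkord; exists (index p L); first by rewrite /= index_mem.
  by rewrite /F /= nth_index // in_itv.
Qed.

(** The right end of a gap belongs to the complement, so some interval p of
    the cover contains it; if the gap has an uncovered point, p starts after
    that point, hence in the half-open interval from the left end (excluded) to
    the right end of the gap.  These half-open intervals are disjoint, so
    distinct uncovered gaps get distinct p.  Thus at most [size L] gaps are not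
    covered, and their total length is at most that of the first [size L]. *)
Lemma tail_le_cover_length (R : realType) (a l r : nat -> R) (L : seq (R * R)) :
  (forall j, (1 <= j)%N -> 0 < a j) ->
  (forall j, (1 <= j)%N -> a j.+1 <= a j) -> subunit_seq a ->
  gap_family a l r -> (forall p, p \in L -> 0 <= p.2) ->
  (forall y, gap_complement l r y ->
     exists2 p, p \in L & p.1 <= y <= p.1 + p.2) ->
  tail_sum a (size L).+1 <= \sum_(p <- L) p.2.
Proof.
move=> a_gt0 a_noninc au lr L0 EL; have [ra lr01 lr_sep] := lr.
have a0 j : (1 <= j)%N -> 0 <= a j by move=> /a_gt0/ltW.
apply: (tail_sum_lim au _).2 => // n.
case: (leqP n (size L).+1) => nL.
  rewrite big_geq // big_seq; apply: sumr_ge0 => p; exact: L0.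
pose covered y := exists2 p, p \in L & p.1 <= y <= p.1 + p.2.
pose good j := `[< forall y, l j < y < r j -> covered y >].
pose s b := [seq j <- index_iota 1 n | good j == b].
have us b : uniq (s b) by rewrite filter_uniq // iota_uniq.
have s1 b j : j \in s b -> (1 <= j)%N.
  by rewrite mem_filter mem_index_iota => /and3P[].
have good_le : \sum_(j <- s true) a j <= \sum_(p <- L) p.2.
  apply: (sum_covered_gaps_le a0 lr) => //; first by move=> j; exact: s1.
  by move=> j y; rewrite mem_filter => /andP[/eqP/asboolP jg _]; exact: jg.
(* p_ j is an interval of the cover that starts in the uncovered gap j. *)
have [p_ p_P] : {p_ : nat -> R * R & forall j, j \in s false ->
    p_ j \in L /\ l j < (p_ j).1 <= r j}.
  have /choice[p_ p_P] : forall j, exists p, j \in s false ->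
      p \in L /\ l j < p.1 <= r j.
    move=> j; have [js|] := boolP (j \in s false); last by exists (0, 0).
    have j0 := s1 _ _ js; have [l0 r1] := lr01 j j0.
    move: js; rewrite mem_filter eqbF_neg => /andP[/asboolPn jbad _].
    have [y lyr yn] : exists2 y, l j < y < r j & ~ covered y.
      apply: contrapT => nex; apply: jbad => y lyr.
      by apply: contrapT => ny; apply: nex; exists y.
    have /andP[ly yr] := lyr.
    have [|p pL /andP[pr rp]] := EL (r j).
      split.
        rewrite /= in_itv /= r1 andbT (le_trans l0) //.
        by rewrite (le_trans (ltW ly)) // ltW.
      move=> [i /= i0]; rewrite in_itv /= => /andP[lir rri].
      have [ij|ij] := pselect (i = j); first by rewrite ij ltxx in rri.
      have [|] := lr_sep i j i0 j0 ij => [ril|rjl].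
        have := lt_trans (lt_trans (lt_le_trans rri ril) ly) yr.
        by rewrite ltxx.
      by have := lt_le_trans lir rjl; rewrite ltxx.
    exists p => _; split=> //; rewrite pr andbT; apply: lt_trans ly _.
    rewrite ltNge; apply/negP => py; apply: yn; exists p => //.
    by rewrite py (le_trans (ltW yr)).
  by exists p_.
(* p_ is injective: the half-open intervals (l i, r i] are disjoint. *)
have sizebad : (size (s false) <= size L)%N.
  rewrite -(size_map p_); apply: uniq_leq_size.
    rewrite map_inj_in_uniq // => i j ib jb pij; apply: contrapT => ij.
    have [_ /andP[li ri]] := p_P i ib; have [_ /andP[lj rj]] := p_P j jb.
    rewrite pij in li ri.
    have [|] := lr_sep i j (s1 _ _ ib) (s1 _ _ jb) ij => rl.
      by have := lt_le_trans lj (le_trans ri rl); rewrite ltxx.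
    by have := lt_le_trans li (le_trans rj rl); rewrite ltxx.
  by move=> _ /mapP[j /p_P[] + _ ->].
have bad_le : \sum_(j <- s false) a j <= \sum_(1 <= j < (size L).+1) a j.
  apply: le_trans (sum_uniq_le_head a_noninc (us _) (s1 _)) _.
  exact: (sum_nat_nondecreasing a0).
have split_gap : \sum_(1 <= i < n) a i = \sum_(1 <= i < (size L).+1) a i
    + \sum_((size L).+1 <= i < n) a i by rewrite -big_cat_nat // ltnW.
have split_good : \sum_(1 <= i < n) a i = \sum_(1 <= i < n | good i) a i
    + \sum_(1 <= i < n | ~~ good i) a i by rewrite [LHS](bigID good).
have goodE : \sum_(1 <= i < n | good i) a i = \sum_(j <- s true) a j.
  by rewrite big_filter; apply: eq_bigl => j; rewrite eqb_id.
have badE : \sum_(1 <= i < n | ~~ good i) a i = \sum_(j <- s false) a j.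
  by rewrite big_filter; apply: eq_bigl => j; rewrite eqbF_neg.
by move: split_good; rewrite goodE badE split_gap; lra.
Qed.

(** * Covering the countable part *)

Lemma finite_coverU (R : realType) (lo hi s eps1 eps2 : R) (F G : set R) :
  finite_cover lo hi F s eps1 -> finite_cover lo hi G s eps2 ->
  finite_cover lo hi (F `|` G) s (eps1 + eps2).
Proof.
move=> [l [dl Fl suml]] [m [dm Gm summ]]; exists (l ++ m); split.
- by move=> p; rewrite mem_cat => /orP[/dl|/dm].
- move=> y [/Fl[p pl py]|/Gm[p pm py]]; exists p => //; rewrite mem_cat.
    by rewrite pl.
  by rewrite pm orbT.
- by rewrite big_cat lerD.
Qed.

Lemma le_finite_cover (R : realType) (lo hi s1 s2 eps1 eps2 : R) (F G : set R) :
  0 < lo -> hi <= 1 -> s1 <= s2 -> eps1 <= eps2 -> G `<=` F ->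
  finite_cover lo hi F s1 eps1 -> finite_cover lo hi G s2 eps2.
Proof.
move=> lo0 hi1 s12 eps12 GF [l [dl Fl suml]]; exists l; split=> //.
  by move=> y /GF/Fl.
apply: le_trans (le_trans suml eps12); rewrite big_seq [leRHS]big_seq.
apply: ler_sum => p /dl/andP[lop phi]; apply: ger_powR => //.
by rewrite (lt_le_trans lo0 lop) (le_trans phi hi1).
Qed.

Lemma stacked_intervals_cover (R : realType) (x : R) (ds : seq R) :
  ds != [::] -> (forall d, d \in ds -> 0 <= d) ->
  exists l : seq (R * R), map snd l = ds /\
    forall y, x <= y <= x + \sum_(d <- ds) d ->
      exists2 p, p \in l & p.1 <= y <= p.1 + p.2.
Proof.
elim: ds x => [//|d ds IHds] x _ ds0.
have [->|dsN] := eqVneq ds [::].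
  exists [:: (x, d)]; split=> // y; rewrite big_seq1 => xy.
  by exists (x, d); rewrite ?mem_head.
have [|l [lds lP]] := IHds (x + d) dsN.
  by move=> e eds; apply: ds0; rewrite inE eds orbT.
exists ((x, d) :: l); split; first by rewrite /= lds.
move=> y; rewrite big_cons addrA => /andP[xy yx].
case: (leP y (x + d)) => [yd|/ltW dy].
  by exists (x, d); rewrite ?mem_head //= xy.
have [|p pl py] := lP y; first by rewrite dy.
by exists p => //; rewrite inE pl orbT.
Qed.

(** D_c translated by B, with its limit point B added. *)
Definition shifted_tails (R : realType) (c : nat -> R) (B : R) : set R :=
  [set x | x = B \/ exists2 k, (1 <= k)%N & x = B + tail_sum c k].

(** The cheapest way to place the gaps: with n intervals of total length at
    least the tail beyond n, one copy of the n lengths, stacked from B, covers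
    all points coming from that tail, and a second copy covers the n others one
    by one. *)
Lemma gap_cover_shifted_tails (R : realType) (a c l r : nat -> R)
    (lo hi s eps B : R) :
  (forall j, (1 <= j)%N -> 0 < a j) ->
  (forall j, (1 <= j)%N -> a j.+1 <= a j) -> subunit_seq a ->
  (forall j, (1 <= j)%N -> 0 <= c j <= a j) -> gap_family a l r -> 0 < lo ->
  finite_cover lo hi (gap_complement l r) s eps ->
  finite_cover lo hi (shifted_tails c B) s (2 * eps).
Proof.
move=> a_gt0 a_noninc au ca lr lo0 [L [dL EL sumL]].
have cu := subunit_seq_le ca au.
have L0 p : p \in L -> 0 <= p.2.
  by move=> /dL/andP[lop _]; exact: ltW (lt_le_trans lo0 lop).
have tailL := tail_le_cover_length a_gt0 a_noninc au lr L0 EL.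
have Lne : map snd L != [::].
  case: L {dL EL sumL L0} tailL => //=; rewrite big_nil leNgt => /negP[].
  by rewrite tail_sum_recl // ltr_pwDl ?a_gt0 ?tail_sum_ge0.
have [|L' [L'L L'P]] := @stacked_intervals_cover _ B _ Lne.
  by move=> _ /mapP[p /L0 + ->].
pose d i := (nth (0, 0) L i).2.
pose M := [seq (B + tail_sum c i.+1, d i) | i <- index_iota 0 (size L)].
have sumM : \sum_(p <- M) p.2 `^ s = \sum_(p <- L) p.2 `^ s.
  by rewrite big_map [RHS](big_nth (0, 0)).
have sumL' : \sum_(p <- L') p.2 `^ s = \sum_(p <- L) p.2 `^ s.
  by rewrite -(big_map snd xpredT (fun d => d `^ s)) L'L big_map.
exists (M ++ L'); split.
- move=> p; rewrite mem_cat => /orP[/mapP[i]|pL'].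
    by rewrite mem_index_iota => /= iL ->; exact: (dL _ (mem_nth (0, 0) iL)).
  have : p.2 \in map snd L by rewrite -L'L map_f.
  by move=> /mapP[q /dL + ->].
- have stacked t : 0 <= t <= tail_sum a (size L).+1 ->
      exists2 p, p \in M ++ L' & p.1 <= B + t <= p.1 + p.2.
    move=> /andP[t0 tL]; have [|p pL' pt] := L'P (B + t).
      by rewrite lerDl t0 lerD2l big_map (le_trans tL).
    by exists p; rewrite // mem_cat pL' orbT.
  move=> y [->|[k k0 ->]].
    by have := stacked 0; rewrite addr0 lexx tail_sum_ge0 //; exact.
  case: (leqP k (size L)) => kL.
    exists (B + tail_sum c k, d k.-1).
      rewrite mem_cat; apply/orP; left; apply/mapP; exists k.-1.
        by rewrite mem_index_iota /= prednK.
      by rewrite prednK.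
    rewrite /= lexx lerDl; apply: L0; rewrite mem_nth //.
    by rewrite prednK.
  apply: stacked; rewrite tail_sum_ge0 //=.
  exact: le_trans (tail_sum_anti cu _ kL) (le_tail_sum ca au _).
- by rewrite big_cat /= sumM sumL'; lra.
Qed.

(** The limit point 0 is covered by repeating one of the lengths already used,
    which at most doubles the cost. *)
Lemma countable_cover_closure (R : realType) (a : nat -> R) (lo hi s eps : R) :
  0 <= lo -> finite_cover lo hi (countable_set a) s eps ->
  finite_cover lo hi (shifted_tails a 0) s (2 * eps).
Proof.
move=> lo0 [L [dL DL sumL]].
have [|p pL _] := DL (tail_sum a 1); first by exists 1%N.
have ps : p.2 `^ s <= eps.
  apply: le_trans sumL; rewrite (perm_big _ (perm_to_rem pL)) big_cons lerDl.
  by apply: sumr_ge0 => q _; exact: powR_ge0.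
exists ((0, p.2) :: L); split.
- by move=> q; rewrite inE => /predU1P[->|/dL //]; exact: (dL _ pL).
- move=> y [->|[k k0 ->]].
    exists (0, p.2); rewrite ?mem_head //= lexx add0r.
    by have /andP[/(le_trans lo0)] := dL _ pL.
  have [|q qL qy] := DL (tail_sum a k); first by exists k.
  by exists q; rewrite ?add0r // inE qL orbT.
- by rewrite big_cons; lra.
Qed.

(** * Geometry of Cantor sets *)

Lemma sum_nat_sub (R : realType) (c : nat -> R) (m m' n n' : nat) :
  (forall i, (m <= i)%N -> 0 <= c i) -> (m <= m')%N -> (n' <= n)%N ->
  \sum_(m' <= i < n') c i <= \sum_(m <= i < n) c i.
Proof.
move=> c0 mm' nn'; have [m'n'|/ltnW n'm'] := leqP m' n'; last first.
  rewrite big_geq // big_nat_cond.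
  by apply: sumr_ge0 => i /andP[/andP[/c0]].
have m'n := leq_trans m'n' nn'.
rewrite (big_cat_nat mm' m'n) /= (big_cat_nat m'n' nn') /=.
have s1 : 0 <= \sum_(m <= i < m') c i.
  by rewrite big_nat_cond; apply: sumr_ge0 => i /andP[/andP[/c0]].
have s2 : 0 <= \sum_(n' <= i < n) c i.
  rewrite big_nat_cond; apply: sumr_ge0 => i /andP[/andP[n'i _] _]; apply: c0.
  exact: leq_trans mm' (leq_trans m'n' n'i).
by lra.
Qed.

Section Cantor.
Context {R : realType} (b : nat -> R).
Hypothesis b_subunit : subunit_seq b.

Let b_ge0 n : (1 <= n)%N -> 0 <= b n. Proof. exact: b_subunit.1. Qed.

(* The total length of the gaps removed from interval j of level k at level
   k + m. *)
Let gap_block k j m : R :=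
  \sum_(0 <= i < 2 ^ m) b (2 ^ (k + m) + 2 ^ m * j + i)%N.

Let gap_block_range k j m :
  gap_block k j m = \sum_(2 ^ (k + m) + 2 ^ m * j <= i <
                         2 ^ (k + m) + 2 ^ m * j + 2 ^ m) b i.
Proof.
rewrite -[X in index_iota X]add0n big_addn addKn.
by apply: eq_bigr => i _; rewrite addnC.
Qed.

Let gap_block_ge0 k j m : 0 <= gap_block k j m.
Proof.
rewrite /gap_block; apply: sumr_ge0 => i _; apply: b_ge0.
by rewrite -addnA addn_gt0 expn_gt0.
Qed.

Let sum_gap_block_le k j n : (j < 2 ^ k)%N ->
  \sum_(0 <= m < n) gap_block k j m <= \sum_(2 ^ k <= i < 2 ^ (k + n)) b i.
Proof.
move=> jk; elim: n => [|n IHn]; first by rewrite !big_geq ?addn0.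
have le1 : (2 ^ k <= 2 ^ (k + n))%N by rewrite leq_exp2l // leq_addr.
have le2 : (2 ^ (k + n) <= 2 ^ (k + n.+1))%N by rewrite leq_exp2l // leq_add2l.
rewrite big_nat_recr //= (big_cat_nat le1 le2) /=.
apply: lerD => //; rewrite gap_block_range; apply: sum_nat_sub.
- by move=> i ki; apply: b_ge0; apply: leq_trans ki; rewrite expn_gt0.
- exact: leq_addr.
- rewrite addnS expnS mul2n -addnn -addnA leq_add2l -mulnSr expnD mulnC.
  by rewrite leq_mul2r jk orbT.
Qed.

Let cantor_len_lim k j : (j < 2 ^ k)%N ->
  (forall n, \sum_(0 <= m < n) gap_block k j m <= cantor_len b k j) /\
  (forall M, (forall n, \sum_(0 <= m < n) gap_block k j m <= M) ->
     cantor_len b k j <= M).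
Proof.
move=> jk; apply: (@nondecreasing_lim _ _ 1).
  exact: sum_nat_nondecreasing.
move=> n; apply: le_trans (sum_gap_block_le n jk) _.
by apply: sum_nat_subunit => //; rewrite expn_gt0.
Qed.

Lemma cantor_len_ge0 k j : (j < 2 ^ k)%N -> 0 <= cantor_len b k j.
Proof.
by move=> jk; have := (cantor_len_lim jk).1 0%N; rewrite big_geq.
Qed.

Lemma cantor_len_bound k j M : (j < 2 ^ k)%N ->
  (forall n, \sum_(0 <= m < n) \sum_(0 <= i < 2 ^ m)
     b (2 ^ (k + m) + 2 ^ m * j + i)%N <= M) -> cantor_len b k j <= M.
Proof. by move=> /cantor_len_lim[_]; exact. Qed.

Let double_lt k j : (j < 2 ^ k)%N -> (j.*2.+1 < 2 ^ k.+1)%N.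
Proof. by move=> jk; rewrite expnS mul2n ltn_Sdouble. Qed.

Let half_lt k j : (j < 2 ^ k.+1)%N -> (j./2 < 2 ^ k)%N.
Proof. by rewrite expnS mul2n ltn_half_double. Qed.

(** The block of level k + m + 1 below interval j consists of the blocks of its
    two children, which are adjacent ranges of indices. *)
Lemma cantor_len_recl k j : (j < 2 ^ k)%N ->
  cantor_len b k j = cantor_len b k.+1 j.*2 + b (2 ^ k + j)%N
                     + cantor_len b k.+1 j.*2.+1.
Proof.
move=> jk.
have j1k := double_lt jk; have j0k := ltnW j1k.
have cv k' j' : (j' < 2 ^ k')%N ->
    \sum_(0 <= m < n) gap_block k' j' m @[n --> \oo] --> cantor_len b k' j'.
  move=> jk'; apply: nondecreasing_is_cvgn; first exact: sum_nat_nondecreasing.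
  exists 1 => _ [n _ <-]; apply: le_trans (sum_gap_block_le n jk') _.
  by apply: sum_nat_subunit => //; rewrite expn_gt0.
have := cv _ _ jk; rewrite -cvg_shiftS /=.
have -> : (fun n => \sum_(0 <= m < n.+1) gap_block k j m) =
    (fun n => \sum_(0 <= m < n) gap_block k.+1 j.*2 m + b (2 ^ k + j)%N
              + \sum_(0 <= m < n) gap_block k.+1 j.*2.+1 m).
  have block0 : gap_block k j 0 = b (2 ^ k + j)%N.
    by rewrite /gap_block expn0 big_nat1 !addn0 mul1n.
  apply/funext => n; rewrite big_nat_recl // block0 addrAC -big_split addrC.
  congr (_ + _).
  apply: eq_bigr => m _; rewrite !gap_block_range.
  set x := (2 ^ (k + m.+1) + 2 ^ m.+1 * j)%N.
  have -> : (2 ^ (k.+1 + m) + 2 ^ m * j.*2 = x)%N.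
    by rewrite /x addSnnS -mul2n mulnA -expnSr.
  have -> : (2 ^ (k.+1 + m) + 2 ^ m * j.*2.+1 = x + 2 ^ m)%N.
    by rewrite /x addSnnS mulnSr -mul2n mulnA -expnSr addnA.
  rewrite -big_cat_nat ?leq_addr //=.
  by rewrite -[in RHS]addnA addnn -mul2n -expnS.
move=> cvL; apply: (cvg_unique _ cvL) => //.
by apply: cvgD; [apply: cvgD; [exact: cv|exact: cvg_cst]|exact: cv].
Qed.

Lemma cantor_len0 : cantor_len b 0 0 = tail_sum b 1.
Proof.
have j0 : (0 < 2 ^ 0)%N by [].
have blocks n : \sum_(0 <= m < n) gap_block 0 0 m = \sum_(1 <= i < 2 ^ n) b i.
  elim: n => [|n IHn]; first by rewrite !big_geq.
  rewrite big_nat_recr //= IHn gap_block_range muln0 addn0 add0n.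
  rewrite -big_cat_nat ?expn_gt0 ?leq_addr //.
  by rewrite addnn -mul2n -expnS.
apply/eqP; rewrite eq_le; apply/andP; split.
  apply: (cantor_len_lim j0).2 => n; rewrite blocks.
  exact: (tail_sum_lim b_subunit _).1.
apply: (tail_sum_lim b_subunit _).2 => // n.
apply: le_trans ((cantor_len_lim j0).1 n); rewrite blocks.
by apply: sum_nat_sub => //; exact/ltnW/ltn_expl.
Qed.

Lemma cantor_left_even k j : cantor_left b k.+1 j.*2 = cantor_left b k j.
Proof. by rewrite /= odd_double doubleK. Qed.

Lemma cantor_left_odd k j : cantor_left b k.+1 j.*2.+1 =
  cantor_left b k j + cantor_len b k.+1 j.*2 + b (2 ^ k + j)%N.
Proof. by rewrite /= odd_double /= uphalf_double. Qed.

Definition cantor_right k j := cantor_left b k j + cantor_len b k j.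

Lemma cantor_left_le_right k j : (j < 2 ^ k)%N ->
  cantor_left b k j <= cantor_right k j.
Proof. by move=> jk; rewrite lerDl cantor_len_ge0. Qed.

Lemma cantor_right_even k j : cantor_right k.+1 j.*2 =
  cantor_left b k j + cantor_len b k.+1 j.*2.
Proof. by rewrite /cantor_right cantor_left_even. Qed.

Lemma cantor_right_odd k j : (j < 2 ^ k)%N ->
  cantor_right k.+1 j.*2.+1 = cantor_right k j.
Proof.
by move=> jk; rewrite /cantor_right cantor_left_odd (cantor_len_recl jk) !addrA.
Qed.

Lemma cantor_child_sub k j : (j < 2 ^ k.+1)%N ->
  cantor_left b k j./2 <= cantor_left b k.+1 j /\
  cantor_right k.+1 j <= cantor_right k j./2.
Proof.
move=> jk; have hk := half_lt jk.
have l0 := cantor_len_ge0 (ltnW (double_lt hk)).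
have l1 := cantor_len_ge0 (double_lt hk).
have b0 : 0 <= b (2 ^ k + j./2)%N by rewrite b_ge0 // addn_gt0 expn_gt0.
rewrite -{2 3}[j]odd_double_half; case: (odd j); rewrite ?add1n ?add0n.
  rewrite cantor_left_odd cantor_right_odd //; split=> //.
  by rewrite -addrA lerDl addr_ge0.
rewrite cantor_left_even cantor_right_even /cantor_right (cantor_len_recl hk).
by split=> //; rewrite lerD2l -addrA lerDl addr_ge0.
Qed.

Lemma cantor_descendant_sub k m j : (j < 2 ^ (k + m))%N ->
  cantor_left b k (j %/ 2 ^ m) <= cantor_left b (k + m) j /\
  cantor_right (k + m) j <= cantor_right k (j %/ 2 ^ m).
Proof.
elim: m j => [|m IHm] j; first by rewrite addn0 expn0 divn1.
rewrite addnS => jk; have [ll rr] := cantor_child_sub jk.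
have [ll' rr'] := IHm _ (half_lt jk).
rewrite expnS divnMA divn2.
by split; [exact: le_trans ll' ll|exact: le_trans rr rr'].
Qed.

End Cantor.

(** * The gaps of a Cantor set *)

Section Cantor_gaps.
Context {R : realType} (b : nat -> R).
Hypothesis b_subunit : subunit_seq b.
Hypothesis b_noninc : forall m n, (1 <= m)%N -> (m <= n)%N -> b n <= b m.

Let b_ge0 n : (1 <= n)%N -> 0 <= b n. Proof. exact: b_subunit.1. Qed.

(** Two intervals of level k are separated by a gap of an earlier level, which
    is at least [b (2 ^ k)] because b is non-increasing. *)
Lemma cantor_itv_separated k i j : (i < j)%N -> (j < 2 ^ k)%N ->
  cantor_right b k i + b (2 ^ k)%N <= cantor_left b k j.
Proof.
elim: k i j => [|k IHk] i j ij; first by case: j ij => [|[]].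
move=> jk; have ik := ltn_trans ij jk.
have h2 m : (m < 2 ^ k.+1)%N -> (m./2 < 2 ^ k)%N.
  by rewrite expnS mul2n ltn_half_double.
have bk : b (2 ^ k.+1)%N <= b (2 ^ k)%N.
  by apply: b_noninc; rewrite ?expn_gt0 // leq_exp2l.
have [_ ri] := cantor_child_sub b_subunit ik.
have [lj _] := cantor_child_sub b_subunit jk.
have [hij|hji] := ltnP i./2 j./2.
  by have := IHk _ _ hij (h2 _ jk); lra.
have hE : i./2 = j./2 by apply/eqP; rewrite eqn_leq hji half_leq // ltnW.
have [iE jE] : i = (i./2).*2 /\ j = (i./2).*2.+1.
  have := odd_double_half i; have := odd_double_half j; rewrite hE.
  by case: (odd i); case: (odd j) => /=; lia.
rewrite jE {1}iE cantor_left_odd // cantor_right_even // lerD2l.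
apply: b_noninc.
  by rewrite addn_gt0 expn_gt0.
by rewrite expnS mul2n -addnn leq_add2l ltnW // h2.
Qed.

Lemma cantor_left_mono k i j : (i <= j)%N -> (j < 2 ^ k)%N ->
  cantor_left b k i <= cantor_left b k j.
Proof.
rewrite leq_eqVlt => /predU1P[->//|ij] jk.
have := cantor_itv_separated ij jk.
have := cantor_left_le_right b_subunit (ltn_trans ij jk).
have := b_ge0 (n := (2 ^ k)%N); rewrite expn_gt0 => /(_ isT); lra.
Qed.

Lemma cantor_right_mono k i j : (i <= j)%N -> (j < 2 ^ k)%N ->
  cantor_right b k i <= cantor_right b k j.
Proof.
rewrite leq_eqVlt => /predU1P[->//|ij] jk.
have := cantor_itv_separated ij jk.
have := cantor_left_le_right b_subunit jk.
have := b_ge0 (n := (2 ^ k)%N); rewrite expn_gt0 => /(_ isT); lra.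
Qed.

(** Left ends persist: the left child has the same left end. *)
Lemma cantor_left_in k j : (j < 2 ^ k)%N -> cantor_set b (cantor_left b k j).
Proof.
move=> jk k' /= _.
have inI q i x : cantor_left b q i <= x -> x <= cantor_right b q i ->
    cantor_itv b q i x.
  by move=> lx xr; rewrite /cantor_itv /= in_itv /= lx.
have [k'k|/ltnW kk'] := leqP k' k.
  rewrite -(subnKC k'k) in jk *.
  have [ll rr] := cantor_descendant_sub b_subunit jk.
  exists (j %/ 2 ^ (k - k'))%N.
    by rewrite /= ltn_divLR ?expn_gt0 // -expnD.
  apply: inI => //; apply: le_trans rr.
  exact: cantor_left_le_right.
have [j' j'k' <-] : exists2 j', (j' < 2 ^ k')%N &
    cantor_left b k' j' = cantor_left b k j.
  rewrite -(subnKC kk'); elim: (k' - k)%N => [|m [j' j'm <-]].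
    by exists j; rewrite addn0.
  exists j'.*2; last by rewrite addnS cantor_left_even.
  by rewrite addnS expnS mul2n ltn_double.
by exists j' => //; apply: inI => //; exact: cantor_left_le_right.
Qed.

Definition cantor_gap_left n :=
  let k := trunc_log 2 n in
  cantor_left b k (n - 2 ^ k) + cantor_len b k.+1 (n - 2 ^ k).*2.

Definition cantor_gap_right n := cantor_gap_left n + b n.

Let level_pos k j : (j < 2 ^ k)%N ->
  trunc_log 2 (2 ^ k + j) = k /\ (2 ^ k + j - 2 ^ k = j)%N.
Proof.
move=> jk; split; last exact: addKn.
by apply: trunc_log_eq; rewrite // leq_addr /= expnS mul2n -addnn ltn_add2l.
Qed.

Let gap_indexP n : (1 <= n)%N ->
  exists k j, (j < 2 ^ k)%N /\ n = (2 ^ k + j)%N.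
Proof.
move=> n0; exists (trunc_log 2 n), (n - 2 ^ trunc_log 2 n)%N.
have /andP[ln nl] := trunc_log_bounds (isT : (1 < 2)%N) n0.
by rewrite subnKC // ltn_subLR //; rewrite addnn -mul2n -expnS.
Qed.

Let gap_leftE k j : (j < 2 ^ k)%N ->
  cantor_gap_left (2 ^ k + j) = cantor_right b k.+1 j.*2.
Proof.
by move=> /level_pos[lE jE]; rewrite /cantor_gap_left lE jE cantor_right_even.
Qed.

Let gap_rightE k j : (j < 2 ^ k)%N ->
  cantor_gap_right (2 ^ k + j) = cantor_left b k.+1 j.*2.+1.
Proof.
move=> jk; rewrite /cantor_gap_right gap_leftE //.
by rewrite cantor_right_even cantor_left_odd.
Qed.

Let gap_sub k j : (j < 2 ^ k)%N ->
  cantor_left b k j <= cantor_gap_left (2 ^ k + j) /\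
  cantor_gap_right (2 ^ k + j) <= cantor_right b k j.
Proof.
move=> jk; have j1k : (j.*2.+1 < 2 ^ k.+1)%N by rewrite expnS mul2n ltn_Sdouble.
rewrite gap_leftE // gap_rightE //; split.
  rewrite cantor_right_even lerDl; apply: cantor_len_ge0 => //; exact: ltnW.
by rewrite -cantor_right_odd //; exact: cantor_left_le_right.
Qed.

(* A gap of level k is bounded by two consecutive intervals of level k + 1, so
   each interval of that level, with all its later gaps, lies on one side. *)
Let gap_itv_separated k j i : (j < 2 ^ k)%N -> (i < 2 ^ k.+1)%N ->
  cantor_right b k.+1 i <= cantor_gap_left (2 ^ k + j) \/
  cantor_gap_right (2 ^ k + j) <= cantor_left b k.+1 i.
Proof.
move=> jk ik; have j1k : (j.*2.+1 < 2 ^ k.+1)%N.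
  by rewrite expnS mul2n ltn_Sdouble.
rewrite gap_leftE // gap_rightE //.
have [ij|ji] := leqP i j.*2; [left|right].
  by apply: cantor_right_mono => //; exact: ltnW.
exact: cantor_left_mono.
Qed.

Lemma cantor_gap_in_range n : (1 <= n)%N ->
  0 <= cantor_gap_left n /\ cantor_gap_right n <= tail_sum b 1.
Proof.
move=> /gap_indexP[k [j [jk ->]]]; have [ll rr] := gap_sub jk.
have [l0 r0] := @cantor_descendant_sub _ _ b_subunit 0 k j jk.
rewrite -cantor_len0 //.
rewrite add0n divn_small // /cantor_right /= add0r in l0 r0.
by split; [exact: le_trans ll|exact: le_trans rr _].
Qed.

Lemma cantor_gaps_separated m n : (1 <= m)%N -> (1 <= n)%N -> m <> n ->
  cantor_gap_right m <= cantor_gap_left n \/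
  cantor_gap_right n <= cantor_gap_left m.
Proof.
move=> /gap_indexP[k [j [jk ->]]] /gap_indexP[k' [j' [jk' ->]]].
wlog kk' : k j jk k' j' jk' / (k <= k')%N.
  move=> H; have [kk'|/ltnW kk'] := leqP k k'; first exact: H.
  by move=> ne; apply/or_comm; apply: H => // /esym.
move=> ne; have [ll rr] := gap_sub jk; have [ll' rr'] := gap_sub jk'.
move: kk'; rewrite leq_eqVlt => /predU1P[kk'|kk'].
  subst k'; have b0 : 0 <= b (2 ^ k)%N by rewrite b_ge0 // expn_gt0.
  have [jj'|j'j|jj'] := ltngtP j j'; last by rewrite jj' in ne.
    by left; have := cantor_itv_separated jj' jk'; lra.
  by right; have := cantor_itv_separated j'j jk; lra.
have jk'2 := jk'; rewrite -(subnKC kk') in jk'2.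
have [l r] := cantor_descendant_sub b_subunit jk'2.
rewrite (subnKC kk') in l r.
have ik : (j' %/ 2 ^ (k' - k.+1) < 2 ^ k.+1)%N.
  by rewrite ltn_divLR ?expn_gt0 // -expnD.
by have [|] := gap_itv_separated jk ik => ?; [right|left]; lra.
Qed.

Lemma cantor_set_gapsP x : cantor_set b x <->
  0 <= x <= tail_sum b 1 /\
  forall n, (1 <= n)%N -> ~ (cantor_gap_left n < x < cantor_gap_right n).
Proof.
split=> [Cx|[/andP[x0 xB] xgap]].
  have inI k : exists2 j, (j < 2 ^ k.+1)%N &
      cantor_left b k.+1 j <= x <= cantor_right b k.+1 j.
    by have [j jk] := Cx k.+1 isT; rewrite /cantor_itv /= in_itv /=; exists j.
  split.
    have [j jk /andP[lx xr]] := inI 0%N.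
    have [] := cantor_child_sub b_subunit jk.
    have -> : j./2 = 0%N by case: j jk {lx xr} => [|[]].
    move=> l0 r0; apply/andP; split; first exact: le_trans l0 lx.
    apply: le_trans xr (le_trans r0 _).
    by rewrite /cantor_right /= add0r cantor_len0.
  move=> n /gap_indexP[k [j [jk ->]]] /andP[gx xg].
  have [i ik /andP[lx xr]] := inI k.
  by have [|] := gap_itv_separated jk ik; lra.
have inI k : exists2 j, (j < 2 ^ k)%N &
    cantor_left b k j <= x <= cantor_right b k j.
  elim: k => [|k [j jk /andP[lx xr]]].
    by exists 0%N => //; rewrite /cantor_right /= add0r cantor_len0 // x0.
  have j1k : (j.*2.+1 < 2 ^ k.+1)%N by rewrite expnS mul2n ltn_Sdouble.
  case: (leP x (cantor_gap_left (2 ^ k + j))) => xl.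
    exists j.*2; first exact: ltnW.
    by rewrite cantor_left_even lx -gap_leftE.
  case: (leP (cantor_gap_right (2 ^ k + j)) x) => xr'.
    by exists j.*2.+1 => //; rewrite cantor_right_odd // xr andbT -gap_rightE.
  by exfalso; apply: (xgap (2 ^ k + j)%N); rewrite ?xl // addn_gt0 expn_gt0.
move=> k /= _; by have [j jk jx] := inI k; exists j.
Qed.

End Cantor_gaps.

(** * Lower bound for covers of a Cantor set *)

Lemma noninc_subunit_le (R : realType) (b : nat -> R) n : subunit_seq b ->
  (forall m n, (1 <= m)%N -> (m <= n)%N -> b n <= b m) -> (1 <= n)%N ->
  n%:R * b n <= 1.
Proof.
move=> bu b_noninc n0; apply: le_trans (bu.2 n.+1).
have <- : \sum_(1 <= i < n.+1) b n = n%:R * b n.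
  by rewrite sumr_const_nat subn1 mulr_natl.
by apply: ler_sum_nat => i /andP[i0 iN]; exact: b_noninc.
Qed.

Lemma exists_expn_inv_le (R : realType) (d : R) : 0 < d ->
  exists k : nat, (2 ^ k)%:R^-1 <= d.
Proof.
move=> d0; exists (Num.truncn d^-1).
rewrite -[leRHS]invrK lef_pV2 ?posrE ?invr_gt0 ?ltr0n ?expn_gt0 //.
apply/ltW/(lt_le_trans (truncnS_gt _)); rewrite ler_nat; exact: ltn_expl.
Qed.

Lemma card_quotient_fiber (N e q : nat) :
  (#|[pred j : 'I_N | j %/ 2 ^ e == q]| <= 2 ^ e)%N.
Proof.
rewrite -[leqRHS]card_ord.
pose f (j : 'I_N) : 'I_(2 ^ e) := Ordinal (ltn_pmod j (expn_gt0 2 e)).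
rewrite -(card_in_imset (f := f)); first exact: max_card.
move=> i j; rewrite !inE => /eqP iq /eqP jq /(congr1 val) /= ij.
by apply: val_inj; rewrite /= (divn_eq i (2 ^ e)) iq ij -jq -divn_eq.
Qed.

Section Cantor_lower_bound.
Context {R : realType} (b : nat -> R).
Hypothesis b_subunit : subunit_seq b.
Hypothesis b_noninc : forall m n, (1 <= m)%N -> (m <= n)%N -> b n <= b m.

Lemma exists_gap_level (d : R) : 0 < d -> d < b 1%N ->
  exists k, b (2 ^ k.+1)%N <= d < b (2 ^ k)%N.
Proof.
move=> d0 d1.
have exk : exists k, b (2 ^ k.+1)%N <= d.
  have [k kd] := exists_expn_inv_le d0; exists k; apply: le_trans kd.
  rewrite -[leRHS]mul1r ler_pdivlMr ?ltr0n ?expn_gt0 // mulrC.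
  apply: le_trans (noninc_subunit_le b_subunit b_noninc (expn_gt0 2 k.+1)).
  rewrite ler_wpM2r ?ler_nat ?leq_exp2l //.
  by apply: b_subunit.1; rewrite expn_gt0.
case: (ex_minnP exk) => k bk kmin; exists k; rewrite bk /=.
case: k kmin {bk} => [//|k] kmin; rewrite ltNge; apply/negP => /kmin.
by rewrite ltnn.
Qed.

(** An interval shorter than [b (2 ^ k)] meets at most one interval of level k,
    so all left ends of level K in it descend from a single ancestor. *)
Lemma cantor_points_in_itv (K k : nat) (x d : R) :
  (k <= K)%N -> d < b (2 ^ k)%N ->
  (#|[pred j : 'I_(2 ^ K) | (x <= cantor_left b K j <= x + d)%R]|
     <= 2 ^ (K - k))%N.
Proof.
move=> kK dk; set A := (X in #|X|).
have [j0 j0A|A0] := pickP A; last by rewrite (eq_card0 A0).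
have anc (j : 'I_(2 ^ K)) : j \in A -> (j %/ 2 ^ (K - k) < 2 ^ k)%N /\
    cantor_left b k (j %/ 2 ^ (K - k)) <= x + d /\
    x <= cantor_right b k (j %/ 2 ^ (K - k)).
  rewrite inE => /andP[xj jx].
  have jK : (j < 2 ^ (k + (K - k)))%N by rewrite subnKC.
  have [l r] := cantor_descendant_sub b_subunit jK.
  rewrite subnKC // in l r.
  have lr := cantor_left_le_right b_subunit (ltn_ord j).
  split; first by rewrite ltn_divLR ?expn_gt0 // -expnD subnKC.
  by split; [exact: le_trans l jx|exact: le_trans xj (le_trans lr r)].
apply: leq_trans (card_quotient_fiber _ _ (j0 %/ 2 ^ (K - k))).
apply: subset_leq_card; apply/fintype.subsetP => j /anc[jk [lj rj]].
have [j0k [l0 r0]] := anc _ j0A.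
rewrite inE; case: ltngtP => // jj0.
  by have := cantor_itv_separated b_subunit b_noninc jj0 j0k; lra.
by have := cantor_itv_separated b_subunit b_noninc jj0 jk; lra.
Qed.

(** Kraft's inequality, by counting the 2^K left ends of a level K beyond all
    levels involved. *)
Lemma cantor_cover_mass (L : seq (R * R)) (lev : R * R -> nat) :
  (forall y, cantor_set b y -> exists2 p, p \in L & p.1 <= y <= p.1 + p.2) ->
  (forall p, p \in L -> p.2 < b (2 ^ lev p)%N) ->
  1 <= \sum_(p <- L) (2 ^ lev p)%:R^-1 :> R.
Proof.
move=> CL levL.
pose K := (\max_(p <- L) lev p)%N.
have levK p : p \in L -> (lev p <= K)%N.
  by move=> pL; exact: (@leq_bigmax_seq _ L xpredT lev).
pose inside p (j : 'I_(2 ^ K)) := p.1 <= cantor_left b K j <= p.1 + p.2.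
have count : (2 ^ K <= \sum_(p <- L) 2 ^ (K - lev p))%N.
  apply: (@leq_trans (\sum_(p <- L) \sum_(j < 2 ^ K) inside p j)%N).
    rewrite exchange_big /= -{1}[(2 ^ K)%N]card_ord -sum1_card.
    apply: leq_sum => j _.
    have [p pL pj] := CL _ (cantor_left_in b_subunit (ltn_ord j)).
    by rewrite (perm_big _ (perm_to_rem pL)) big_cons /= /inside pj.
  rewrite big_seq [leqRHS]big_seq; apply: leq_sum => p pL.
  rewrite -big_mkcond /= sum1_card.
  by apply: cantor_points_in_itv; [exact: levK|exact: levL].
have K0 : 0 < (2 ^ K)%:R :> R by rewrite ltr0n expn_gt0.
rewrite -(ler_pM2l K0) mulr1 mulr_sumr.
apply: (@le_trans _ _ (\sum_(p <- L) (2 ^ (K - lev p))%:R)).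
  by rewrite -natr_sum ler_nat.
rewrite big_seq [leRHS]big_seq; apply: ler_sum => p pL.
rewrite ler_pdivlMr ?ltr0n ?expn_gt0 // -natrM -expnD subnK //.
exact: levK.
Qed.

(** The weights [2 ^ - lev p] have sum at least 1, so the cost is at least a
    weighted mean of the single-level costs [2 ^ lev p * p.2 `^ s]; one of those
    is therefore no larger than the whole cost. *)
Lemma cantor_cover_level (lo hi s eps : R) : 0 < lo -> hi < b 1%N ->
  finite_cover lo hi (cantor_set b) s eps ->
  exists k d, [/\ lo <= d <= hi, b (2 ^ k.+1)%N <= d, d < b (2 ^ k)%N
                & (2 ^ k)%:R * d `^ s <= eps].
Proof.
move=> lo0 hi1 [L [dL CL sumL]].
have /choice[lev levP] : forall p : R * R, exists k, p \in L ->
    b (2 ^ k.+1)%N <= p.2 < b (2 ^ k)%N.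
  move=> p; have [pL|_] := boolP (p \in L); last by exists 0%N.
  have /andP[lop phi] := dL _ pL.
  have [k] := exists_gap_level (lt_le_trans lo0 lop) (le_lt_trans phi hi1).
  by exists k.
have mass : 1 <= \sum_(p <- L) (2 ^ lev p)%:R^-1 :> R.
  by apply: cantor_cover_mass => // p /levP/andP[].
apply: contrapT => nex.
have expensive p : p \in L -> eps * (2 ^ lev p)%:R^-1 < p.2 `^ s.
  move=> pL; rewrite ltr_pdivrMr ?ltr0n ?expn_gt0 // mulrC ltNge.
  apply/negP => cheap; apply: nex; exists (lev p), p.2.
  by have /andP[? ?] := levP _ pL; split=> //; exact: dL.
have eps0 : 0 <= eps.
  by apply: le_trans sumL; apply: sumr_ge0 => p _; exact: powR_ge0.
have [p pL _] := CL _ (cantor_left_in b_subunit (isT : (0 < 2 ^ 0)%N)).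
(* One strict inequality suffices, and the cover has a member p because it
   covers the left end 0. *)
suff : eps * \sum_(p <- L) (2 ^ lev p)%:R^-1 < \sum_(p <- L) p.2 `^ s.
  by rewrite ltNge (le_trans sumL) // -[leLHS]mulr1 ler_wpM2l.
rewrite mulr_sumr !(perm_big _ (perm_to_rem pL)) !big_cons.
apply: ltr_leD; first exact: expensive.
rewrite big_seq [leRHS]big_seq; apply: ler_sum => q /mem_rem qL.
exact/ltW/expensive.
Qed.

End Cantor_lower_bound.

(** * Gluing a countable arrangement to a given arrangement of some gaps *)

Definition off_indices (R : realType) (a : nat -> R) (S : pred nat)
    (j : nat) : R :=
  if S j then 0 else a j.

(** The gaps with indices in S are given inside [0, B]; the others fill [B, 1]
    in decreasing order from right to left, as in D_a.  Replacing by 0 the terms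
    with index in S avoids renumbering: these terms only create empty
    intervals. *)
Section Glue.
Context {R : realType} (a : nat -> R) (S : pred nat) (B : R) (lS rS : nat -> R).
Hypothesis a_subunit : subunit_seq a.
Let c := off_indices a S.
Hypothesis B0 : 0 <= B.
Hypothesis Bc : B + tail_sum c 1 = 1.
Hypothesis rSE : forall j, S j -> rS j = lS j + a j.
Hypothesis S_range : forall j, S j -> 0 <= lS j /\ rS j <= B.
Hypothesis S_separated : forall i j, S i -> S j -> i <> j ->
  rS i <= lS j \/ rS j <= lS i.

Definition glued_left j := if S j then lS j else B + tail_sum c j.+1.
Definition glued_right j := if S j then rS j else B + tail_sum c j.

Lemma off_indices_le j : (1 <= j)%N -> 0 <= c j <= a j.
Proof.
move=> j0; rewrite /c /off_indices.
by case: ifP; rewrite ?lexx ?andbT; move=> _; exact: a_subunit.1.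
Qed.

Let c_subunit : subunit_seq c.
Proof. exact: (subunit_seq_le off_indices_le a_subunit). Qed.

Lemma glued_gap_family : gap_family a glued_left glued_right.
Proof.
split.
- move=> j j0; rewrite /glued_left /glued_right; case: ifP => Sj.
    exact: rSE.
  by rewrite (tail_sum_recl c_subunit j0) {1}/c /off_indices Sj; lra.
- move=> j j0; rewrite /glued_left /glued_right; case: ifP => Sj.
    have [l0 rB] := S_range Sj.
    have t0 := @tail_sum_ge0 _ c 1 c_subunit isT.
    by split=> //; rewrite -Bc (le_trans rB) // lerDl.
  have t0 := @tail_sum_ge0 _ c j.+1 c_subunit isT.
  have t1 := @tail_sum_anti _ c 1 j c_subunit isT j0.
  by split; [rewrite addr_ge0|rewrite -Bc lerD2l].
- have tail0 i : (1 <= i)%N -> 0 <= tail_sum c i by exact: tail_sum_ge0.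
  move=> i j i0 j0 ij; rewrite /glued_left /glued_right.
  case: ifP => Si; case: ifP => Sj; first exact: S_separated.
  + by left; have [_] := S_range Si; have := tail0 j.+1 isT; lra.
  + by right; have [_] := S_range Sj; have := tail0 i.+1 isT; lra.
  + rewrite !lerD2l; have [ij'|ji'|//] := ltngtP i j.
      by right; exact: tail_sum_anti.
    by left; exact: tail_sum_anti.
Qed.

Lemma glued_complement_sub x : gap_complement glued_left glued_right x ->
  (0 <= x <= B /\ forall j, (1 <= j)%N -> S j -> ~ (lS j < x < rS j)) \/
  shifted_tails c B x.
Proof.
move=> [/=]; rewrite in_itv /= => /andP[x0 x1] xgap.
have gapN j : (1 <= j)%N -> ~ (glued_left j < x < glued_right j).
  by move=> j0 xj; apply: xgap; exists j => //=; rewrite in_itv.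
have [xB|Bx] := leP x B.
  left; rewrite x0; split=> // j j0 Sj.
  by have := gapN j j0; rewrite /glued_left /glued_right Sj.
right; right.
have ex_tail : exists n, (1 <= n)%N && (B + tail_sum c n.+1 < x).
  have [|n n0 cn] := tail_sum_small c_subunit (e := x - B).
    by rewrite subr_gt0.
  exists n; rewrite n0 /=.
  by have := @tail_sum_anti _ c n n.+1 c_subunit n0 (leqnSn _); lra.
case: (ex_minnP ex_tail) => n /andP[n0 cn] nmin; exists n => //.
have xn : x <= B + tail_sum c n.
  case: n n0 {cn} nmin => [//|[|n]] _ nmin; first by rewrite Bc.
  rewrite leNgt; apply/negP => cn.
  by have := nmin n.+1; rewrite cn => /(_ isT); rewrite ltnn.
have := gapN n n0; rewrite /glued_left /glued_right; case: ifP => Sn.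
  have c0 : c n = 0 by rewrite /c /off_indices Sn.
  move: xn; rewrite (tail_sum_recl c_subunit n0) c0 add0r => xn.
  by have := le_lt_trans xn cn; rewrite ltxx.
rewrite cn /= => /negP; rewrite -leNgt => nx.
by apply/eqP; rewrite eq_le xn nx.
Qed.

Lemma sub_glued_complement x : 0 <= x <= B ->
  (forall j, (1 <= j)%N -> S j -> ~ (lS j < x < rS j)) ->
  gap_complement glued_left glued_right x.
Proof.
move=> /andP[x0 xB] xgap; split.
  rewrite /= in_itv /= x0 -Bc (le_trans xB) // lerDl.
  exact: tail_sum_ge0.
move=> [j j0]; rewrite /= in_itv /= /glued_left /glued_right.
case: ifP => Sj; first exact: xgap.
have := @tail_sum_ge0 _ c j.+1 c_subunit isT.
by move=> t0 /andP[tx _]; have := lt_le_trans tx xB; lra.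
Qed.

End Glue.

(** * Thinned sequences *)

Section Thinning.
Context {R : realType}.
Implicit Types (a : nat -> R) (lam : R) (k n : nat).

Definition thin_level lam k := Num.truncn (k%:R / lam).

(** Position j of level k, numbered [2 ^ k + j], is sent to position j of level
    [thin_level lam k]. *)
Definition thin_index lam n :=
  let k := trunc_log 2 n in (2 ^ thin_level lam k + (n - 2 ^ k))%N.

Definition thin a lam n := a (thin_index lam n).

Section Lam.
Context (lam : R).
Hypothesis lam01 : 0 < lam <= 1.

Let lam0 : 0 < lam. Proof. by have /andP[] := lam01. Qed.

Lemma thin_level_itv k :
  (thin_level lam k)%:R <= k%:R / lam < (thin_level lam k).+1%:R.
Proof. by apply: truncn_itv; rewrite divr_ge0 // ltW. Qed.

Lemma thin_level_lt k : (thin_level lam k < thin_level lam k.+1)%N.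
Proof.
have /andP[lk _] := thin_level_itv k; have /andP[_ kl] := thin_level_itv k.+1.
have inv1 : 1 <= lam^-1 by rewrite invf_ge1 //; have /andP[] := lam01.
rewrite -ltnS -(ltr_nat R); apply: le_lt_trans kl.
by rewrite -!natr1 mulrDl mul1r; apply: lerD.
Qed.

Lemma thin_level_addn k m : (thin_level lam k + m <= thin_level lam (k + m))%N.
Proof.
elim: m => [|m IHm]; first by rewrite !addn0.
by rewrite !addnS; apply: leq_ltn_trans IHm (thin_level_lt _).
Qed.

Lemma thin_level_ge k : (k <= thin_level lam k)%N.
Proof. exact: leq_trans (leq_addl _ _) (thin_level_addn 0 k). Qed.

Lemma thin_indexE k i : (i < 2 ^ k)%N ->
  thin_index lam (2 ^ k + i) = (2 ^ thin_level lam k + i)%N.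
Proof.
move=> ik; rewrite /thin_index (_ : trunc_log 2 _ = k) ?addKn //.
by apply: trunc_log_eq; rewrite // leq_addr /= expnS mul2n -addnn ltn_add2l.
Qed.

Lemma thin_index_ge n : (n <= thin_index lam n)%N.
Proof.
case: n => [//|n]; rewrite /thin_index; set k := trunc_log 2 _.
have kn : (2 ^ k <= n.+1)%N by apply: trunc_logP.
by rewrite -{1}(subnKC kn) leq_add2r leq_exp2l // thin_level_ge.
Qed.

Lemma thin_index_lt m n : (1 <= m)%N -> (m < n)%N ->
  (thin_index lam m < thin_index lam n)%N.
Proof.
move=> m0 mn; have n0 := leq_trans m0 (ltnW mn).
have := trunc_log_bounds (isT : (1 < 2)%N) m0.
have := trunc_log_bounds (isT : (1 < 2)%N) n0.
rewrite /thin_index; have := leq_trunc_log 2 (ltnW mn).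
set k := trunc_log 2 m; set k' := trunc_log 2 n.
rewrite leq_eqVlt => /predU1P[<-|kk'] /andP[n1 n2] /andP[m1 m2].
  by rewrite ltn_add2l ltn_sub2r //; apply: leq_ltn_trans mn.
apply: (@leq_trans (2 ^ thin_level lam k + 2 ^ k)%N).
  by rewrite ltn_add2l ltn_subLR // addnn -mul2n -expnS.
apply: leq_trans (leq_addr _ _).
apply: (@leq_trans (2 ^ (thin_level lam k).+1)%N).
  by rewrite expnS mul2n -addnn leq_add2l leq_exp2l // thin_level_ge.
rewrite leq_exp2l // -(subnKC kk').
apply: leq_trans (thin_level_lt k) _.
exact: leq_trans (leq_addr _ _) (thin_level_addn _ _).
Qed.

Lemma thin_index_inj m n : (1 <= m)%N -> (1 <= n)%N ->
  thin_index lam m = thin_index lam n -> m = n.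
Proof.
move=> m0 n0 mn; have [lt_mn|lt_nm|//] := ltngtP m n.
  by have := thin_index_lt m0 lt_mn; rewrite mn ltnn.
by have := thin_index_lt n0 lt_nm; rewrite mn ltnn.
Qed.

Lemma thin_index_gt0 n : (1 <= n)%N -> (1 <= thin_index lam n)%N.
Proof. by move=> n0; exact: leq_trans n0 (thin_index_ge n). Qed.

Lemma thin_noninc a :
  (forall m n, (1 <= m)%N -> (m <= n)%N -> a n <= a m) ->
  forall m n, (1 <= m)%N -> (m <= n)%N -> thin a lam n <= thin a lam m.
Proof.
move=> a_mono m n m0; rewrite leq_eqVlt => /predU1P[->//|mn].
by apply: a_mono; [exact: thin_index_gt0|exact/ltnW/thin_index_lt].
Qed.

Let uniq_thin n : uniq [seq thin_index lam i | i <- index_iota 1 n].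
Proof.
rewrite map_inj_in_uniq ?iota_uniq // => i j.
rewrite !mem_index_iota => /andP[i0 _] /andP[j0 _]; exact: thin_index_inj.
Qed.

Lemma thin_subunit a : subunit_seq a -> subunit_seq (thin a lam).
Proof.
move=> au; split; first by move=> n n0; apply: au.1; exact: thin_index_gt0.
move=> n; rewrite -(big_map (thin_index lam) xpredT a).
apply: subunit_sum_uniq => // _ /mapP[i + ->].
by rewrite mem_index_iota => /andP[/thin_index_gt0].
Qed.

Definition thin_range : pred nat :=
  fun j => `[< exists2 n, (1 <= n)%N & thin_index lam n = j >].

(** Splitting the series of a along the range of the injection [thin_index lam].
    Both inequalities compare finite sums over duplicate-free lists of
    indices; [thin_index_ge] bounds the preimages of the indices below n. *)
Lemma thin_tail_sum a : subunit_seq a -> tail_sum a 1 = 1 ->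
  tail_sum (thin a lam) 1 + tail_sum (off_indices a thin_range) 1 = 1.
Proof.
move=> au a1; have bu := thin_subunit au.
set c := off_indices _ _; have cu : subunit_seq c.
  exact: (subunit_seq_le (off_indices_le _ au) au).
have c_sum n : \sum_(1 <= j < n) c j = \sum_(1 <= j < n | ~~ thin_range j) a j.
  rewrite [RHS]big_mkcond; apply: eq_bigr => j _.
  by rewrite /c /off_indices; case: ifP.
apply/eqP; rewrite eq_le; apply/andP; split.
  rewrite -lerBrDr; apply: (tail_sum_lim bu _).2 => // n.
  rewrite lerBrDl -lerBrDr; apply: (tail_sum_lim cu _).2 => // m.
  rewrite lerBrDr c_sum -big_filter -(big_map (thin_index lam) xpredT a).
  rewrite -big_cat.
  apply: subunit_sum_uniq => //.
    rewrite cat_uniq uniq_thin filter_uniq ?iota_uniq // andbT.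
    apply/hasPn => j /= /mapP[i]; rewrite mem_index_iota => /andP[i0 _] ->.
    rewrite mem_filter negb_and negbK; apply/orP; left.
    by apply/asboolP; exists i.
  move=> j; rewrite mem_cat mem_filter => /orP[/andP[_]|/mapP[i + ->]].
    by rewrite mem_index_iota => /andP[].
  by rewrite mem_index_iota => /andP[/thin_index_gt0].
rewrite -a1; apply: (tail_sum_lim au _).2 => // n.
rewrite (bigID thin_range) /= -c_sum; apply: lerD; last first.
  exact: (tail_sum_lim cu _).1.
apply: le_trans ((tail_sum_lim bu _).1 n) => //.
rewrite -big_filter -(big_map (thin_index lam) xpredT a).
rewrite [leRHS](bigID (mem [seq j <- index_iota 1 n | thin_range j])) /=.
rewrite -[leLHS]addr0; apply: lerD; last first.
  rewrite big_seq_cond; apply: sumr_ge0 => j /andP[/mapP[i + ->] _].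
  by rewrite mem_index_iota => /andP[i0 _]; apply: au.1; exact: thin_index_gt0.
rewrite -[leRHS]big_filter le_eqVlt; apply/predU1l; apply: perm_big.
apply: uniq_perm; rewrite ?filter_uniq ?iota_uniq // => j.
rewrite !mem_filter; apply/idP/idP => [|/andP[]//].
move=> /andP[Sj]; rewrite mem_index_iota => /andP[j0 jn].
rewrite Sj j0 jn /=; have /asboolP[i i0 ij] := Sj.
apply/mapP; exists i => //; rewrite mem_index_iota i0 /=.
by apply: leq_ltn_trans jn; rewrite -ij thin_index_ge.
Qed.

End Lam.

Lemma thin_index1 n : (1 <= n)%N -> thin_index 1 n = n.
Proof.
move=> n0; rewrite /thin_index /thin_level divr1 natrK subnKC //.
exact: trunc_logP.
Qed.

End Thinning.

(** * Covers of thinned Cantor sets *)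

Section Dyadic.
Context {R : realType} (a : nat -> R).
Hypothesis a_subunit : subunit_seq a.
Hypothesis a_mono : forall m n, (1 <= m)%N -> (m <= n)%N -> a n <= a m.

Let expn2_gt0 k : 0 < (2 ^ k)%:R :> R. Proof. by rewrite ltr0n expn_gt0. Qed.

Lemma dyadic_avgE n : dyadic_avg a n = (2 ^ n)%:R^-1 * tail_sum a (2 ^ n).
Proof. by rewrite /dyadic_avg natrX. Qed.

Lemma dyadic_avg_halving n r :
  dyadic_avg a (n + r) <= (2 ^ r)%:R^-1 * dyadic_avg a n.
Proof.
rewrite !dyadic_avgE mulrA -invfM -natrM -expnD addnC.
rewrite ler_wpM2l ?invr_ge0 //.
by apply: tail_sum_anti; rewrite ?expn_gt0 // leq_exp2l // leq_addl.
Qed.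

Lemma dyadic_avg_ge0 n : 0 <= dyadic_avg a n.
Proof. by rewrite dyadic_avgE mulr_ge0 ?invr_ge0 ?tail_sum_ge0 ?expn_gt0. Qed.

Lemma dyadic_avg_anti m n : (m <= n)%N -> dyadic_avg a n <= dyadic_avg a m.
Proof.
move=> mn; rewrite -(subnKC mn); apply: le_trans (dyadic_avg_halving _ _) _.
by rewrite ler_piMl ?dyadic_avg_ge0 // invf_le1 // ler1n expn_gt0.
Qed.

Lemma dyadic_avg_le n : dyadic_avg a n <= (2 ^ n)%:R^-1.
Proof.
rewrite dyadic_avgE ler_piMr ?invr_ge0 //; apply: (tail_sum_lim a_subunit _).2.
  by rewrite expn_gt0.
by move=> m; apply: sum_nat_subunit; rewrite ?expn_gt0.
Qed.

Lemma dyadic_block_le n : dyadic_avg a n - 2 * dyadic_avg a n.+1 <= a (2 ^ n)%N.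
Proof.
have n0 : (0 < 2 ^ n)%N by rewrite expn_gt0.
have nn : (2 ^ n <= 2 ^ n.+1)%N by rewrite leq_exp2l.
have half x : 2 * ((2 ^ n.+1)%:R^-1 * x) = (2 ^ n)%:R^-1 * x :> R.
  by rewrite expnS natrM invfM !mulrA divff ?mul1r // pnatr_eq0.
rewrite !dyadic_avgE half (tail_sum_split a_subunit n0 nn) -mulrBr addrK.
rewrite mulrC ler_pdivrMr // mulr_natr.
rewrite (_ : a (2 ^ n)%N *+ 2 ^ n = \sum_(2 ^ n <= i < 2 ^ n.+1) a (2 ^ n)%N).
  by apply: ler_sum_nat => i /andP[ni _]; exact: a_mono.
by rewrite sumr_const_nat expnS mul2n -addnn addnK.
Qed.

(** If [q > 2] is a lower bound of the ratios, then
    [(1 - 2 / q) * s_n <= s_n - 2 * s_(n+1)], and the right-hand side is the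
    mean of the dyadic block of a that starts at [2 ^ n], hence at most its
    first term.  Since s is at least halved at each step, it suffices that
    [2 ^ - r <= 1 - 2 / q]. *)
Lemma dyadic_gap_lower_bound :
  (forall n, (1 <= n)%N -> 0 < a n) ->
  (2%:E < ereal_inf
     (range (fun n => (dyadic_avg a n / dyadic_avg a n.+1)%:E)))%E ->
  exists r, forall n, dyadic_avg a (n + r) <= a (2 ^ n)%N.
Proof.
move=> a_gt0 ratio_inf.
have s_gt0 n : 0 < dyadic_avg a n.
  rewrite dyadic_avgE mulr_gt0 ?invr_gt0 // tail_sum_recl ?expn_gt0 //.
  by rewrite ltr_pwDl ?a_gt0 ?tail_sum_ge0 ?expn_gt0.
have [q q2 qratio] : exists2 q : R, 2 < q & forall n,
    q * dyadic_avg a n.+1 <= dyadic_avg a n.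
  set I := ereal_inf _ in ratio_inf.
  have I_le n : (I <= (dyadic_avg a n / dyadic_avg a n.+1)%:E)%E.
    by apply: ereal_inf_lbound; exists n.
  move: I ratio_inf I_le => [q||] // q2 qle; last by have := qle 0%N.
  exists q; first by rewrite -lte_fin.
  by move=> n; have := qle n; rewrite lee_fin ler_pdivlMr.
have q'0 : 0 < 1 - 2 / q by rewrite subr_gt0 ltr_pdivrMr; lra.
have [r rq] := exists_expn_inv_le q'0; exists r => n.
apply: le_trans (dyadic_avg_halving _ _) _.
apply: le_trans (ler_wpM2r (dyadic_avg_ge0 n) rq) _.
apply: le_trans (dyadic_block_le n); rewrite mulrBl mul1r lerD2l lerN2.
rewrite -mulrA ler_pM2l // mulrC ler_pdivlMr; first by rewrite mulrC.
by lra.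
Qed.

Section Thin_cover.
Context (lam : R).
Hypothesis lam01 : 0 < lam <= 1.
Let b := thin a lam.
Let b_subunit : subunit_seq b. Proof. exact: thin_subunit. Qed.
Let b_mono : forall m n, (1 <= m)%N -> (m <= n)%N -> b n <= b m.
Proof. exact: thin_noninc. Qed.

Lemma thin_expn k : b (2 ^ k)%N = a (2 ^ thin_level lam k)%N.
Proof.
by rewrite /b /thin -[X in thin_index _ X]addn0 thin_indexE ?expn_gt0 // addn0.
Qed.

(** The gaps of level k + m are at most [a (2 ^ (thin_level lam k + m))], a term
    dominated by the mean of the preceding dyadic block; the blocks add up to
    a tail sum of a. *)
Lemma thin_cantor_len_le k j : (1 <= k)%N -> (j < 2 ^ k)%N ->
  cantor_len b k j <= dyadic_avg a (thin_level lam k).-1.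
Proof.
move=> k0 jk; have Lk0 := leq_trans k0 (thin_level_ge lam01 k).
set M := (thin_level lam k).-1.
have ME : thin_level lam k = M.+1 by rewrite prednK.
have dyadic_cat n :
    \sum_(0 <= m < n) \sum_(2 ^ (M + m) <= i < 2 ^ (M + m.+1)) a i
    = \sum_(2 ^ M <= i < 2 ^ (M + n)) a i.
  elim: n => [|n IHn]; first by rewrite !big_geq ?addn0.
  by rewrite big_nat_recr //= IHn -big_cat_nat // leq_exp2l //
    ?leq_addr // leq_add2l.
apply: cantor_len_bound => // n.
apply: (@le_trans _ _ ((2 ^ M)%:R^-1 * \sum_(2 ^ M <= i < 2 ^ (M + n)) a i));
    last first.
  rewrite dyadic_avgE ler_wpM2l ?invr_ge0 //.
  by apply: (tail_sum_lim a_subunit _).1; rewrite expn_gt0.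
rewrite -dyadic_cat mulr_sumr; apply: ler_sum_nat => m _.
apply: (@le_trans _ _ (\sum_(0 <= i < 2 ^ m) a (2 ^ (M + m.+1))%N)).
  apply: ler_sum_nat => i _.
  apply: (@le_trans _ _ (b (2 ^ (k + m))%N)).
    by apply: b_mono; rewrite ?expn_gt0 // -addnA leq_addr.
  rewrite thin_expn; apply: a_mono; rewrite ?expn_gt0 // leq_exp2l //.
  by rewrite addnS -addSn -ME; exact: thin_level_addn.
rewrite sumr_const_nat subn0 -[leLHS]mulr_natl.
rewrite ler_pdivlMl // mulrA -natrM -expnD.
apply: (@le_trans _ _ (\sum_(2 ^ (M + m) <= i < 2 ^ (M + m.+1))
                          a (2 ^ (M + m.+1))%N)).
  by rewrite sumr_const_nat addnS expnS mul2n -addnn addnK mulr_natl.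
apply: ler_sum_nat => i /andP[mi im]; apply: a_mono; last exact: ltnW.
by apply: leq_trans mi; rewrite expn_gt0.
Qed.

Lemma thin_cantor_cover (lo hi s d : R) k : (1 <= k)%N -> lo <= d <= hi ->
  dyadic_avg a (thin_level lam k).-1 <= d ->
  finite_cover lo hi (cantor_set b) s ((2 ^ k)%:R * d `^ s).
Proof.
move=> k0 dI sd.
exists [seq (cantor_left b k j, d) | j <- index_iota 0 (2 ^ k)].
split.
- by move=> p /mapP[j _ ->].
- move=> y /(_ _ k0)[j /= jk]; rewrite /cantor_itv /= in_itv /= => /andP[ly yr].
  exists (cantor_left b k j, d).
    by apply/mapP; exists j; rewrite ?mem_index_iota.
  rewrite /= ly (le_trans yr) // lerD2l.
  exact: le_trans (thin_cantor_len_le k0 jk) sd.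
- rewrite big_map (eq_bigr (fun=> d `^ s)) //.
  by rewrite sumr_const_nat subn0 mulr_natl.
Qed.

(** [thin_level lam k > x] as soon as [k > lam * (x + 2)]. *)
Lemma exists_thin_level (x : nat) : exists2 k, (1 <= k)%N /\
  (x < thin_level lam k)%N & k%:R <= lam * (x%:R + 2) + 1.
Proof.
have /andP[lam0 lam1] := lam01.
have x2 : 0 <= lam * (x%:R + 2).
  by apply: mulr_ge0; [exact: ltW|exact: addr_ge0].
have /andP[tl tr] := truncn_itv x2; set t := Num.truncn _ in tl tr.
exists t.+1; last by rewrite -natr1 lerD2r.
split=> //; have /andP[_] := thin_level_itv lam01 t.+1.
rewrite -(ltr_nat R); move: tr; rewrite mulrC -ltr_pdivlMr //.
by rewrite -(natr1 (thin_level _ _)); lra.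
Qed.

End Thin_cover.

Lemma powR2n k : 2 `^ k%:R = (2 ^ k)%:R :> R.
Proof. by rewrite powR_mulrn // natrX. Qed.

(** A length d that is used at level k for [lam] serves for [lam'] at a level k'
    bounded by [k + eta * thin_level lam k + C0].  The factor
    [2 ^ (eta * thin_level lam k)] is compensated by [d `^ eta], because
    [d < a (2 ^ thin_level lam k) <= 2 ^ - thin_level lam k]. *)
Lemma cantor_cover_transfer (lam lam' eta : R) (r : nat) :
  0 < lam <= 1 -> 0 < lam' <= 1 -> 0 <= eta -> lam' <= lam + eta ->
  (forall n, dyadic_avg a (n + r) <= a (2 ^ n)%N) ->
  exists2 C : R, 0 < C & forall lo hi s eps, 0 < lo -> hi < a 1%N ->
    finite_cover lo hi (cantor_set (thin a lam)) s eps ->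
    finite_cover lo hi (cantor_set (thin a lam')) (s + eta) (C * eps).
Proof.
move=> lam01 lam'01 eta0 lam_eta rP.
have /andP[lam0 lam1] := lam01; have /andP[lam'0 lam'1] := lam'01.
(* C0 collects the shift r and the roundings in thin_level. *)
pose C0 : R := eta * (1 + lam^-1) + r%:R + 4.
exists (2 `^ C0); first exact: powR_gt0.
move=> lo hi s eps lo0 hi1 covL.
have thin1 : thin a lam 1 = a 1%N.
  rewrite -[X in thin a lam X](expn0 2) thin_expn /thin_level mul0r.
  by rewrite (_ : Num.truncn 0 = 0%N) // truncn0.
have [|k [d [dI bd db cost]]] := cantor_cover_level
    (thin_subunit lam01 a_subunit) (thin_noninc lam01 a_mono) lo0 _ covL.
  by rewrite thin1.
rewrite thin_expn // in bd; rewrite thin_expn // in db.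
have d0 : 0 < d by have /andP[lod _] := dI; exact: lt_le_trans lod.
set L := thin_level lam k in db; set L1 := thin_level lam k.+1 in bd.
have [k' [k'0 xk'] k'_le] := exists_thin_level lam'01 (L1 + r).
have k'd : dyadic_avg a (thin_level lam' k').-1 <= d.
  apply: le_trans bd; apply: le_trans (rP L1).
  by apply: dyadic_avg_anti; rewrite -ltnS prednK //; exact: leq_ltn_trans xk'.
have := thin_cantor_cover lam'01 (s + eta) k'0 dI k'd.
move=> [l [dl Fl suml]]; exists l; split=> //; apply: le_trans suml _.
apply: le_trans _ (ler_wpM2l (powR_ge0 _ _) cost).
have Ld : 2 `^ L%:R * d <= 1.
  have := noninc_subunit_le a_subunit a_mono (expn_gt0 2 L).
  rewrite powR2n; apply: le_trans; rewrite ler_pM2l //; exact: ltW.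
(* The factor that grows with k is paid for by the larger exponent. *)
have Ldeta : 2 `^ (L%:R * eta) * d `^ eta <= 1.
  rewrite powRrM -powRM ?powR_ge0 //; last exact: ltW.
  apply: (@le_trans _ _ (1 `^ eta)); last by rewrite powR1.
  apply: ge0_ler_powR; rewrite ?nnegrE //.
  by apply: mulr_ge0; [exact: powR_ge0|exact: ltW].
have k'C : k'%:R <= C0 + k%:R + L%:R * eta.
  have /andP[L1_le _] := thin_level_itv lam01 k.+1.
  have /andP[_ k_lt] := thin_level_itv lam01 k.
  rewrite -/L1 -/L -!natr1 in L1_le k_lt; rewrite natrD in k'_le.
  have lamV : lam * lam^-1 = 1 by rewrite divff ?gt_eqF.
  have h1 : lam' * (L1%:R + r%:R + 2) <= lam' * L1%:R + r%:R + 2.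
    have : lam' * (r%:R + 2) <= r%:R + 2 by rewrite ler_piMl ?addr_ge0.
    by lra.
  have h2 : lam' * L1%:R <= (lam + eta) * ((k%:R + 1) / lam).
    by apply: ler_pM => //; exact: ltW.
  have h3 : (lam + eta) * ((k%:R + 1) / lam) =
      k%:R + 1 + eta * ((k%:R + 1) / lam).
    by rewrite mulrDl mulrCA lamV mulr1.
  have h4 : eta * ((k%:R + 1) / lam) <= eta * (L%:R + 1 + lam^-1).
    by rewrite ler_wpM2l // mulrDl mul1r lerD2r ltW.
  by rewrite /C0; lra.
rewrite powRD; last by rewrite (gt_eqF d0) implybT.
rewrite -powR2n.
apply: (@le_trans _ _ (2 `^ (C0 + k%:R + L%:R * eta) * (d `^ s * d `^ eta))).
  by rewrite ler_wpM2r ?mulr_ge0 ?powR_ge0 // ler_powR // ler1n.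
have pow2D x y : 2 `^ (x + y) = 2 `^ x * 2 `^ y :> R.
  by rewrite powRD // pnatr_eq0 implybT.
rewrite pow2D [2 `^ (C0 + _)]pow2D (powR2n k).
have C00 : 0 <= 2 `^ C0 * ((2 ^ k)%:R * d `^ s).
  by rewrite !mulr_ge0 ?powR_ge0.
rewrite -[leRHS]mulr1; apply: le_trans _ (ler_wpM2l C00 Ldeta).
by rewrite le_eqVlt; apply/predU1l; ring.
Qed.

End Dyadic.

(** * The interpolating sets *)

(** Empty for [lam = 0], where [thin_level] would divide by 0 and all gaps go to
    the countable part. *)
Definition cantor_part (R : realType) (a : nat -> R) (lam : R) : set R :=
  if lam == 0 then set0 else cantor_set (thin a lam).

(** What the comparison of dimensions uses of the set E_lam.  It is squeezed
    between its Cantor part and the union of that part with the countable one;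
    c is a with the gaps spent on the Cantor part replaced by 0, and B is the
    right end of the Cantor part. *)
Definition interpolates (R : realType) (a : nat -> R) (lam : R) (E : set R) :=
  exists l r c B,
    [/\ gap_family a l r, E = gap_complement l r,
        forall j, (1 <= j)%N -> 0 <= c j <= a j,
        E `<=` cantor_part a lam `|` shifted_tails c B
      & cantor_part a lam `<=` E] /\
    (lam = 0 -> E `<=` shifted_tails a 0).

(** [thin] alters the value at 0, so only values from 1 on can be compared. *)
Lemma cantor_set_ext (R : realType) (a b : nat -> R) :
  (forall n, (1 <= n)%N -> a n = b n) -> cantor_set a = cantor_set b.
Proof.
move=> ab.
have len k j : cantor_len a k j = cantor_len b k j.
  rewrite /cantor_len; congr (limn _); apply/funext => n.
  apply: eq_bigr => m _; apply: eq_bigr => i _.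
  by rewrite ab // -addnA addn_gt0 expn_gt0.
have left k j : cantor_left a k j = cantor_left b k j.
  elim: k j => [//|k IHk] j /=; rewrite !IHk len ab //.
  by rewrite addn_gt0 expn_gt0.
rewrite /cantor_set; apply: eq_bigcapr => k _; apply: eq_bigcupr => j _.
by rewrite /cantor_itv left len.
Qed.

Lemma thin1_cantor_set (R : realType) (a : nat -> R) :
  cantor_set (thin a 1) = cantor_set a.
Proof. by apply: cantor_set_ext => n n0; rewrite /thin thin_index1. Qed.

Lemma gap_complement_unit (R : realType) (l r : nat -> R) :
  gap_complement l r `<=` `[0, 1]%classic.
Proof. by move=> x []. Qed.

Section Domination.
Context {R : realType} (theta : R).
Hypothesis theta01 : 0 < theta <= 1.
Implicit Types (F G : set R) (eta : R).

Lemma cover_dominatedU eta F G1 G2 :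
  cover_dominated theta eta F G1 -> cover_dominated theta eta F G2 ->
  cover_dominated theta eta F (G1 `|` G2).
Proof.
move=> FG1 FG2 s e eps s0 e0 eps0; have eps20 : 0 < eps / 2 by lra.
have [eps1 eps10 [d1 d10 H1]] := FG1 s e _ s0 e0 eps20.
have [eps2 eps20' [d2 d20 H2]] := FG2 s e _ s0 e0 eps20.
exists (Num.min eps1 eps2); first by rewrite lt_min eps10.
exists (Num.min d1 d2); first by rewrite lt_min d10.
move=> delta /andP[delta0]; rewrite le_min => /andP[dd1 dd2] [l [dl Fl suml]].
rewrite [eps](_ : _ = eps / 2 + eps / 2); last by lra.
by apply: finite_coverU; [apply: H1|apply: H2]; rewrite ?delta0 //;
  exists l; split=> //; apply: le_trans suml _; rewrite ge_min lexx ?orbT.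
Qed.

Lemma cover_dominated_linear (C d1 eta : R) F G : 0 < C -> 0 < d1 ->
  (forall lo hi s eps, 0 < lo -> hi <= d1 -> 0 <= s -> hi <= 1 ->
     finite_cover lo hi F s eps -> finite_cover lo hi G (s + eta) (C * eps)) ->
  cover_dominated theta eta F G.
Proof.
move=> C0 d10 FG s e eps s0 e0 eps0; exists (eps / C); first exact: divr_gt0.
exists (Num.min 1 d1); first by rewrite lt_min ltr01.
move=> delta /andP[delta0]; rewrite le_min => /andP[delta1 dd1] H.
have lo0 : 0 < delta `^ theta^-1 by exact: powR_gt0.
have := FG _ _ s _ lo0 dd1 s0 delta1 H; apply: le_finite_cover => //.
  by rewrite lerDl ltW.
by rewrite mulrCA divff ?mulr1 // gt_eqF.
Qed.

Lemma cover_dominated_sub eta F G G' : G' `<=` G ->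
  cover_dominated theta eta F G -> cover_dominated theta eta F G'.
Proof.
move=> GG' FG s e eps s0 e0 eps0.
have [eps1 eps10 [d1 d10 H1]] := FG s e eps s0 e0 eps0.
exists eps1 => //; exists d1 => // delta dd /(H1 _ dd)[l [dl Gl suml]].
by exists l; split=> // y /GG'/Gl.
Qed.

Lemma cover_dominated_mono eta eta' F G : eta <= eta' ->
  cover_dominated theta eta F G -> cover_dominated theta eta' F G.
Proof.
move=> ee FG s e eps s0 e0 eps0.
have e'0 : 0 < eta' - eta + e by lra.
have [eps1 eps10 [d1 d10 H1]] := FG s _ eps s0 e'0 eps0.
exists eps1 => //; exists d1 => // delta dd /(H1 _ dd).
by rewrite (_ : s + eta + (eta' - eta + e) = s + eta' + e) //; lra.
Qed.

Lemma cover_dominated_subset F G : G `<=` F -> cover_dominated theta 0 F G.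
Proof.
move=> GF; apply: (@cover_dominated_linear 1 1) => // lo hi s eps _ _ _ _.
rewrite addr0 mul1r => -[l [dl Fl suml]].
by exists l; split=> // y /GF/Fl.
Qed.

Section Interpolation.
Context (a : nat -> R).
Hypothesis a_gt0 : forall n, (1 <= n)%N -> 0 < a n.
Hypothesis a_noninc : forall n, (1 <= n)%N -> a n.+1 <= a n.
Hypothesis a_mono : forall m n, (1 <= m)%N -> (m <= n)%N -> a n <= a m.
Hypothesis a_subunit : subunit_seq a.
Hypothesis a_sum1 : tail_sum a 1 = 1.

Lemma exists_interpolates (lam : R) : 0 <= lam <= 1 ->
  exists E, interpolates a lam E.
Proof.
move=> /andP[]; rewrite le_eqVlt => /predU1P[<- _|lam0 lam1].
  have E0sub x : gap_complement (glued_left a pred0 0 (fun=> 0))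
      (glued_right a pred0 0 (fun=> 0)) x -> shifted_tails a 0 x.
    move=> /(glued_complement_sub a_subunit)[||//].
      by rewrite add0r.
    by move=> [x0 _]; left; apply/eqP; rewrite eq_le andbC.
  exists (gap_complement (glued_left a pred0 0 (fun=> 0))
    (glued_right a pred0 0 (fun=> 0))).
  exists (glued_left a pred0 0 (fun=> 0)),
    (glued_right a pred0 0 (fun=> 0)), a, 0.
  split; last by move=> _.
  split=> //.
  - by apply: glued_gap_family => //; rewrite add0r.
  - by move=> j j0; rewrite lexx ltW ?a_gt0.
  - by move=> x /E0sub; right.
  - by rewrite /cantor_part eqxx.
have lam01 : 0 < lam <= 1 by rewrite lam0.
pose b := thin a lam.
have bu : subunit_seq b by exact: thin_subunit.
have b_mono : forall m n, (1 <= m)%N -> (m <= n)%N -> b n <= b m.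
  exact: thin_noninc.
(* psi inverts thin_index lam on its range; elsewhere its value is 0. *)
have /choice[psi psiP] : forall j, exists n, thin_range lam j ->
    (1 <= n)%N /\ thin_index lam n = j.
  move=> j; have [/asboolP[n n0 nj]|_] := boolP (thin_range lam j).
    by exists n.
  by exists 0%N.
have psiK n : (1 <= n)%N ->
    thin_range lam (thin_index lam n) /\ psi (thin_index lam n) = n.
  move=> n0; have Sn : thin_range lam (thin_index lam n).
    by apply/asboolP; exists n.
  by have [p0 pn] := psiP _ Sn; split=> //; exact: thin_index_inj pn.
pose lS j := cantor_gap_left b (psi j); pose rS j := cantor_gap_right b (psi j).
pose B := tail_sum b 1.
have B0 : 0 <= B by exact: tail_sum_ge0.
have Bc : B + tail_sum (off_indices a (thin_range lam)) 1 = 1.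
  exact: thin_tail_sum.
have rSE j : thin_range lam j -> rS j = lS j + a j.
  by move=> /psiP[n0 nj]; rewrite /rS /cantor_gap_right /b /thin nj.
have S_range j : thin_range lam j -> 0 <= lS j /\ rS j <= B.
  by move=> /psiP[n0 _]; exact: cantor_gap_in_range.
have S_sep i j : thin_range lam i -> thin_range lam j -> i <> j ->
    rS i <= lS j \/ rS j <= lS i.
  move=> /psiP[i0 pi] /psiP[j0 pj] ij; apply: cantor_gaps_separated => //.
  by move=> pij; apply: ij; rewrite -pi -pj pij.
set l := glued_left a (thin_range lam) B lS.
set r := glued_right a (thin_range lam) B rS.
have partE : cantor_part a lam = cantor_set b by rewrite /cantor_part gt_eqF.
exists (gap_complement l r), l, r, (off_indices a (thin_range lam)), B.
split; last by move=> lamE; rewrite lamE ltxx in lam0.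
split=> //.
- exact: glued_gap_family.
- exact: off_indices_le.
- move=> x /(glued_complement_sub a_subunit Bc)[[x0 xgap]|]; [left|by right].
  rewrite partE; apply/(cantor_set_gapsP bu b_mono); split=> // n n0.
  have [Sn psin] := psiK n n0.
  have := xgap _ (thin_index_gt0 lam01 n0) Sn.
  by rewrite /lS /rS psin.
- rewrite partE => x /(cantor_set_gapsP bu b_mono)[x0 xgap].
  apply: sub_glued_complement => // j j0 /psiP[n0 _]; exact: xgap.
Qed.

Lemma cover_dominated_tails l r c B : gap_family a l r ->
  (forall j, (1 <= j)%N -> 0 <= c j <= a j) ->
  cover_dominated theta 0 (gap_complement l r) (shifted_tails c B).
Proof.
move=> lr ca; apply: (@cover_dominated_linear 2 1) => // lo hi s eps lo0 _ _ _.
by rewrite addr0; exact: (gap_cover_shifted_tails B a_gt0 a_noninc).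
Qed.

(** Whatever F is, delta alone as length covers the Cantor part at a level k
    with [2 ^ k] at most a constant times [delta `^ (- lam)], so that the cost
    at any exponent beyond [lam] vanishes with delta. *)
Lemma thin_cantor_dominated (lam : R) F : 0 < lam <= 1 ->
  cover_dominated theta lam F (cantor_set (thin a lam)).
Proof.
move=> lam01 s e eps s0 e0 eps0; have /andP[lam0 lam1] := lam01.
exists 1 => //; exists (Num.min 1 ((eps / 16) `^ e^-1)).
  by rewrite lt_min ltr01 powR_gt0 // divr_gt0.
move=> delta /andP[delta0]; rewrite le_min => /andP[delta1 deltae] _.
(* 2^-x is the largest power of 1/2 below delta, hence at least delta / 2 unless
   x = 0. *)
have [x xd xx] : exists2 x : nat,
    (2 ^ x)%:R^-1 <= delta & (2 ^ x)%:R <= 2 / delta.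
  have exk := exists_expn_inv_le delta0.
  case: (ex_minnP exk) => x xd xmin; exists x => //.
  rewrite ler_pdivlMr //; case: x xmin {xd} => [|x] xmin.
    by rewrite expn0 mul1r; lra.
  rewrite expnS natrM -mulrA ler_piMr //.
  have : ~~ ((2 ^ x)%:R^-1 <= delta) by apply/negP => /xmin; rewrite ltnn.
  rewrite -ltNge => /ltW.
  rewrite -[X in _ <= X]mul1r ler_pdivlMr ?ltr0n ?expn_gt0 //.
  by rewrite mulrC.
have [k [k0 xk] k_le] := exists_thin_level lam01 x.
have dI : delta `^ theta^-1 <= delta <= delta.
  by rewrite lexx andbT; apply: powR_inv_le => //; rewrite delta0.
have kd : dyadic_avg a (thin_level lam k).-1 <= delta.
  apply: le_trans xd; apply: le_trans (dyadic_avg_le a_subunit _) => //.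
  apply: dyadic_avg_anti => //; rewrite -ltnS prednK //.
  exact: leq_ltn_trans xk.
have := thin_cantor_cover a_subunit a_mono lam01 (s + lam + e) k0 dI kd.
move=> [l [dl Gl suml]]; exists l; split=> //; apply: le_trans suml _.
have pow2D u v : 2 `^ (u + v) = 2 `^ u * 2 `^ v :> R.
  by rewrite powRD // pnatr_eq0 implybT.
have k2 : (2 ^ k)%:R <= 16 * delta `^ (- lam).
  apply: (@le_trans _ _ (2 `^ (x%:R * lam + 3))).
    rewrite -powR2n; apply: ler_powR; rewrite ?ler1n //; apply: le_trans k_le _.
    by lra.
  rewrite pow2D powRrM !powR2n.
  have xlam : (2 ^ x)%:R `^ lam <= (2 / delta) `^ lam.
    by apply: ge0_ler_powR; rewrite ?nnegrE ?divr_ge0 // ltW.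
  have two : 2 `^ lam <= 2 :> R.
    by rewrite -[leRHS]powRr1 //; apply: ler_powR => //; rewrite ler1n.
  have split_pow : (2 / delta) `^ lam = 2 `^ lam * delta `^ (- lam).
    rewrite powRM ?invr_ge0 // ?(ltW delta0) //; congr (_ * _).
    by rewrite -[delta^-1]powR_inv1 ?(ltW delta0) // -powRrM mulN1r.
  have := ler_wpM2r (powR_ge0 delta (- lam)) two.
  by move: xlam; rewrite split_pow; lra.
apply: (@le_trans _ _ (16 * delta `^ (s + e))).
  rewrite (_ : s + e = - lam + (s + lam + e)); last by lra.
  rewrite [X in 16 * X]powRD; last by rewrite (gt_eqF delta0) implybT.
  by rewrite mulrA ler_wpM2r ?powR_ge0.
have : delta `^ (s + e) <= eps / 16; last by lra.
apply: (@le_trans _ _ (delta `^ e)).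
  by apply: ger_powR; rewrite ?delta0 // lerDr.
rewrite -[leRHS]powRr1; last by rewrite divr_ge0 // ltW.
rewrite -[X in _ <= _ `^ X](mulVf (lt0r_neq0 e0)).
rewrite powRrM; apply: ge0_ler_powR; rewrite ?nnegrE ?powR_ge0 //; exact: ltW.
Qed.

Lemma interpolates_dominated (lam lam' eta : R) E E' r :
  (forall n, dyadic_avg a (n + r) <= a (2 ^ n)%N) ->
  0 <= lam <= 1 -> 0 <= lam' <= 1 -> 0 <= eta -> lam' <= lam + eta ->
  interpolates a lam E -> interpolates a lam' E' ->
  cover_dominated theta eta E E'.
Proof.
move=> rP lam01 lam'01 eta0 lam_eta.
move=> [l [r1 [c [B [[lr -> ca _ CE] _]]]]].
move=> [l' [r1' [c' [B' [[_ _ c'a E'C _] _]]]]].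
apply: (cover_dominated_sub E'C); apply: cover_dominatedU; last first.
  apply: (@cover_dominated_mono 0 eta) => //; exact: cover_dominated_tails.
rewrite /cantor_part in CE *; case: ifPn => [_|lam'0].
  by apply: (cover_dominated_mono eta0); apply: cover_dominated_subset.
have lam'01' : 0 < lam' <= 1 by rewrite lt_neqAle eq_sym lam'0.
have [lam0|lam0] := eqVneq lam 0.
  apply: (@cover_dominated_mono lam'); last exact: thin_cantor_dominated.
  by move: lam_eta; rewrite lam0 add0r.
have lam01' : 0 < lam <= 1 by rewrite lt_neqAle eq_sym lam0.
rewrite (negbTE lam0) in CE.
have [C C0 H] :=
  cantor_cover_transfer a_subunit a_mono lam01' lam'01' eta0 lam_eta rP.
have a10 : 0 < a 1%N / 2 by rewrite divr_gt0 // a_gt0.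
apply: (cover_dominated_linear C0 a10).
move=> lo hi s eps lo0 hi1 _ _ [L [dL FL sumL]].
apply: H => //; first by have := a_gt0 (isT : (1 <= 1)%N); lra.
by exists L; split=> // y /CE/FL.
Qed.

Lemma countable_set_unit : countable_set a `<=` `[0, 1]%classic.
Proof.
move=> x [k k0 <-]; rewrite /= in_itv /= tail_sum_ge0 //=.
by rewrite -a_sum1 tail_sum_anti.
Qed.

(** Stated for any [dim] that respects domination, so as to cover the upper and
    the lower dimension at once. *)
Lemma interpolate_dimension (dim : set R -> R) (t : R) r :
  (forall n, dyadic_avg a (n + r) <= a (2 ^ n)%N) ->
  (forall eta F G, 0 <= eta -> F `<=` `[0, 1]%classic ->
     cover_dominated theta eta F G -> dim G <= dim F + eta) ->
  dim (countable_set a) <= t <= dim (cantor_set a) ->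
  exists E, complementary_set a E /\ dim E = t.
Proof.
move=> rP dim_le /andP[Dt tC].
have /choice[E EP] : forall lam, exists E,
    0 <= lam <= 1 -> interpolates a lam E.
  move=> lam; have [lam01|_] := boolP (0 <= lam <= 1); last by exists set0.
  by have [E ?] := exists_interpolates lam01; exists E.
have E_unit lam : 0 <= lam <= 1 -> E lam `<=` `[0, 1]%classic.
  by move=> /EP[l [r1 [c [B [[_ -> _ _ _] _]]]]]; exact: gap_complement_unit.
have lip x y : 0 <= x -> x <= y -> y <= 1 ->
    dim (E x) <= dim (E y) <= dim (E x) + (y - x).
  move=> x0 xy y1.
  have x01 : 0 <= x <= 1 by rewrite x0 (le_trans xy).
  have y01 : 0 <= y <= 1 by rewrite (le_trans x0).
  apply/andP; split.
    rewrite -[leRHS]addr0; apply: dim_le => //; first exact: E_unit.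
    apply: (interpolates_dominated rP y01 x01 _ _ (EP y y01) (EP x x01)) => //.
    by rewrite addr0.
  apply: dim_le; [by rewrite subr_ge0|exact: E_unit|].
  apply: (interpolates_dominated rP x01 y01 _ _ (EP x x01) (EP y y01)).
    by rewrite subr_ge0.
  by rewrite addrC subrK.
have z01 : 0 <= (0 : R) <= 1 by rewrite lexx ler01.
have o01 : 0 <= (1 : R) <= 1 by rewrite lexx ler01.
have E0 : dim (E 0) <= t.
  apply: le_trans Dt; rewrite -[leRHS]addr0; apply: dim_le => //.
    exact: countable_set_unit.
  have [l [r1 [c [B [_ Esub]]]]] := EP 0 z01.
  apply: (cover_dominated_sub (Esub erefl)).
  apply: (@cover_dominated_linear 2 1) => // lo hi s eps lo0 _ _ _.
  by rewrite addr0; apply: countable_cover_closure; exact: ltW.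
have E1 : t <= dim (E 1).
  apply: (le_trans tC); rewrite -[leRHS]addr0; apply: dim_le => //.
    exact: E_unit.
  apply: cover_dominated_subset; rewrite -thin1_cantor_set.
  have [l [r1 [c [B [[_ _ _ _ CE] _]]]]] := EP 1 o01.
  by move: CE; rewrite /cantor_part oner_eq0.
have [|lam lam01 lamt] := lipschitz_intermediate_value lip (t := t).
  by rewrite E0 E1.
exists (E lam); split=> //.
have [l [r1 [c [B [[lr -> _ _ _] _]]]]] := EP lam lam01.
exact: gap_complement_complementary.
Qed.

End Interpolation.

End Domination.

Theorem theorem6p1 (R : realType) (theta : R) (a : nat -> R)
  (theta01 : 0 < theta <= 1)
  (a_gt0 : forall n : nat, (1 <= n)%N -> 0 < a n)
  (a_noninc : forall n : nat, (1 <= n)%N -> a n.+1 <= a n)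
  (a_sum1 : \sum_(1 <= i < n) a i @[n --> \oo] --> (1 : R))
  (ratio_inf : (2%:E <
     ereal_inf (range (fun n : nat => (dyadic_avg a n / dyadic_avg a n.+1)%:E)))%E)
  (ratio_sup :
     (ereal_sup (range (fun n : nat => (dyadic_avg a n / dyadic_avg a n.+1)%:E))
       < +oo)%E) :
  (forall t : R,
     upper_intermediate_dim theta (countable_set a) <= t
       <= upper_intermediate_dim theta (cantor_set a) ->
     exists E : set R,
       complementary_set a E /\ upper_intermediate_dim theta E = t) /\
  (forall t : R,
     lower_intermediate_dim theta (countable_set a) <= t
       <= lower_intermediate_dim theta (cantor_set a) ->
     exists E : set R,
       complementary_set a E /\ lower_intermediate_dim theta E = t).
Proof.
have a_ge0 n : (1 <= n)%N -> 0 <= a n by move=> /a_gt0/ltW.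
have [a_subunit a_tail] := cvg_sum1_subunit a_ge0 a_sum1.
have a_mono := noninc_from1 a_noninc.
have [r rP] := dyadic_gap_lower_bound a_subunit a_mono a_gt0 ratio_inf.
split=> t; apply: (interpolate_dimension theta01 a_gt0 a_noninc a_mono
  a_subunit a_tail rP) => eta F G.
- exact: upper_dim_le.
- exact: lower_dim_le.
Qed.
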